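(* For every prime $p\equiv 5\pmod 8$ with $p\geq 13$, there exists an intransitive directed strongly regular graph $\Gamma$ with parameters $(v,k,t,\lambda,\mu)=(4p+2,\,2p,\,p,\,p-1,\,p)$ whose Weisfeiler--Leman closure $\operatorname{WL}(\Gamma)$ is a homogeneous noncommutative association scheme of rank six. Consequently, there exist infinitely many intransitive directed strongly regular graphs having homogeneous noncommutative Weisfeiler--Leman closure of the smallest possible rank (namely six).
   Context: All graphs, digraphs and configurations are finite. $I$ and $J$ denote the identity matrix and the all-one matrix of the appropriate order. A digraph $\Gamma=(V,\mathcal A)$ consists of a finite vertex set $V$ and a set of arcs $\mathcal A\subseteq V\times V$; all digraphs are loopless, and both $(x,y)$ and $(y,x)$ may be arcs. Its adjacency matrix $A$ is the $(0,1)$-matrix with $A_{xy}=1$ iff $(x,y)\in\mathcal A$. A loopless digraph is a directed strongly regular graph (DSRG) with parameters $(v,k,t,\lambda,\mu)$ if $|V|=v$ and $AJ=JA=kJ$ and $A^2=tI+\lambda A+\mu(J-I-A)$. It is proper if $0<t<k$. $\operatorname{Aut}(\Gamma)$ is the group of permutations of $V$ preserving the arc set; $\Gamma$ is vertex-transitive if $\operatorname{Aut}(\Gamma)$ is transitive on $V$, and intransitive otherwise. A coherent configuration on a finite set $\Omega$ is a partition $\mathcal R=\{R_0,\dots,R_{r-1}\}$ of $\Omega\times\Omega$ such that: (1) the diagonal $1_\Omega=\{(x,x):x\in\Omega\}$ is a union of members of $\mathcal R$; (2) the transpose of each $R_i$ is in $\mathcal R$; (3) for all $i,j,k$ there is a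 nonnegative integer $p_{ij}^k$ such that for every $(x,y)\in R_k$, $|\{z\in\Omega:(x,z)\in R_i,(z,y)\in R_j\}|=p_{ij}^k$. The $R_i$ are the basis relations and $r$ is the rank. Its adjacency algebra is the complex span of the adjacency matrices of the $R_i$. It is homogeneous if $1_\Omega$ is itself a basis relation; an association scheme means a homogeneous coherent configuration; it is commutative if its adjacency algebra is commutative, and noncommutative otherwise. The Weisfeiler--Leman closure $\operatorname{WL}(\Gamma)$ of a digraph $\Gamma$ is the smallest (i.e. coarsest) coherent configuration on $V$ whose adjacency algebra contains the adjacency matrix of $\Gamma$; equivalently, the smallest coherent configuration in which the arc relation of $\Gamma$ is a union of basis relations. ''Smallest possible rank'' refers to the known fact that if a proper DSRG has arc relation equal to a nontrivial union of basis relations of an association scheme, then that association scheme is noncommutative and has rank at least six. *)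

(* Defs.v *)
(* Mathematical Components; the complex numbers are R[i] over the classical
   real numbers R of the Stdlib. *)
From mathcomp Require Import all_boot all_order all_algebra all_fingroup.
From mathcomp Require Import reals Rstruct complex.
From Stdlib Require Rdefinitions.

Set Implicit Arguments.
Unset Strict Implicit.
Unset Printing Implicit Defensive.

Import GRing.Theory.
Local Open Scope ring_scope.

Definition C : numClosedFieldType := (Rdefinitions.R)[i].

(* Rows and columns are indexed by the elements of V through enum_val. *)
Definition adjmx (V : finType) (D : {set V * V}) : 'M[C]_#|V| :=
  \matrix_(i, j) ((enum_val i, enum_val j) \in D)%:R.

Definition allone (n : nat) : 'M[C]_n := const_mx 1.

Structure digraph := Digraph {
  vertex :> finType;
  arcs : {set vertex * vertex};
  arcs_loopless : forall x, (x, x) \notin arcs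
}.

Definition digraph_iso (G H : digraph) : Prop :=
  exists2 f : G -> H, bijective f &
    forall x y, ((f x, f y) \in arcs H) = ((x, y) \in arcs G).

Definition digraph_aut (G : digraph) : {set {perm G}} :=
  [set s : {perm G} | [forall x, forall y,
     ((s x, s y) \in arcs G) == ((x, y) \in arcs G)]].

Lemma digraph_autP (G : digraph) (s : {perm G}) :
  reflect (forall x y, ((s x, s y) \in arcs G) = ((x, y) \in arcs G))
          (s \in digraph_aut G).
Proof.
rewrite inE; apply: (iffP forallP) => [h x y | h x].
  by have /forallP/(_ y)/eqP := h x.
by apply/forallP => y; rewrite h.
Qed.

Fact digraph_aut_group_set (G : digraph) : group_set (digraph_aut G).
Proof.
apply/group_setP; split=> [|s t /digraph_autP hs /digraph_autP ht].
  by apply/digraph_autP => x y; rewrite !perm1.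
by apply/digraph_autP => x y; rewrite !permM ht hs.
Qed.

Canonical digraph_aut_group (G : digraph) := Group (digraph_aut_group_set G).

Definition vertex_transitive (G : digraph) : Prop :=
  [transitive digraph_aut G, on [set: G] | 'P]%g.

Definition intransitive (G : digraph) : Prop := ~ vertex_transitive G.

Definition dsrg (G : digraph) (v k t l m : nat) : Prop :=
  let A := adjmx (arcs G) in
  let J := allone #|G| in
  [/\ #|G| = v,
      A *m J = k%:R *: J,
      J *m A = k%:R *: J &
      A *m A = t%:R *: 1%:M + l%:R *: A + m%:R *: (J - 1%:M - A)].

Definition proper_dsrg (G : digraph) (v k t l m : nat) : Prop :=
  dsrg G v k t l m /\ (0 < t < k)%N.

Section Configurations.

Variable V : finType.
Implicit Types (D R : {set V * V}) (S T : {set {set V * V}}).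

Definition diag_rel : {set V * V} := [set u | u.1 == u.2].

Definition transpose_rel R : {set V * V} := [set u | (u.2, u.1) \in R].

Definition union_of_basis S D : Prop :=
  exists2 P : {set {set V * V}}, P \subset S & cover P = D.

Definition coherent S : Prop :=
  [/\ partition S [set: V * V],
      union_of_basis S diag_rel,
      (forall R, R \in S -> transpose_rel R \in S) &
      (forall R1 R2 R3, R1 \in S -> R2 \in S -> R3 \in S ->
         exists q : nat, forall x y, (x, y) \in R3 ->
           #|[set z | ((x, z) \in R1) && ((z, y) \in R2)]| = q)].

Definition rank S : nat := #|S|.

Definition adjacency_algebra S : {vspace 'M[C]_#|V|} :=
  <<[seq adjmx R | R <- enum S]>>%VS.

Definition homogeneous S : Prop := diag_rel \in S.

Definition association_scheme S : Prop := coherent S /\ homogeneous S.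

Definition commutative_config S : Prop :=
  forall M N : 'M[C]_#|V|,
    M \in adjacency_algebra S -> N \in adjacency_algebra S -> M *m N = N *m M.

Definition noncommutative S : Prop := ~ commutative_config S.

(* S <= T in the usual order on configurations: T refines S. *)
Definition coarser S T : Prop :=
  forall R, R \in T -> exists2 R', R' \in S & R \subset R'.

Lemma coarser_anti S T :
  partition S [set: V * V] -> partition T [set: V * V] ->
  coarser S T -> coarser T S -> S = T.
Proof.
suff sub S1 S2 : partition S1 [set: V * V] -> partition S2 [set: V * V] ->
    coarser S1 S2 -> coarser S2 S1 -> S1 \subset S2.
  by move=> pS pT hST hTS; apply/eqP; rewrite eqEsubset !sub.
move=> /and3P[_ tS S0] _ h12 h21; apply/subsetP => R RS.
have [R' R'T sRR'] := h21 _ RS; have [R2 R2S sR'R2] := h12 _ R'T.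
have [x xR] : exists x, x \in R.
  by apply/set0Pn; apply: contraNneq S0 => <-.
have eR : R2 = R.
  have xR2 := subsetP sR'R2 _ (subsetP sRR' _ xR).
  by rewrite -(def_pblock tS R2S xR2) (def_pblock tS RS xR).
suff -> : R = R' by [].
by apply/eqP; rewrite eqEsubset sRR' -{1}eR sR'R2.
Qed.

End Configurations.

(* S = WL(G), as the least element of its defining family. *)
Definition is_WL_closure (G : digraph) (S : {set {set G * G}}) : Prop :=
  [/\ coherent S,
      adjmx (arcs G) \in adjacency_algebra S &
      forall T : {set {set G * G}}, coherent T ->
        adjmx (arcs G) \in adjacency_algebra T -> coarser S T].

Arguments is_WL_closure : clear implicits.

Lemma is_WL_closure_unique (G : digraph) (S T : {set {set G * G}}) :
  is_WL_closure G S -> is_WL_closure G T -> S = T.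
Proof.
move=> [cS aS mS] [cT aT mT].
by apply: coarser_anti; [case: cS | case: cT | exact: mS | exact: mT].
Qed.

Definition has_noncommutative_WL_scheme_of_rank (G : digraph) (r : nat) : Prop :=
  exists S : {set {set G * G}},
    [/\ is_WL_closure G S, association_scheme S, noncommutative S & rank S = r].

(* A union giving the arcs of a proper DSRG is automatically nontrivial. *)
Definition scheme_of_proper_dsrg (G : digraph) (S : {set {set G * G}}) : Prop :=
  [/\ exists v k t l m, proper_dsrg G v k t l m,
      association_scheme S & union_of_basis S (arcs G)].

Arguments scheme_of_proper_dsrg : clear implicits.

Definition smallest_possible_rank (r : nat) : Prop :=
  (exists G : digraph, exists2 S : {set {set G * G}},
     scheme_of_proper_dsrg G S & rank S = r) /\
  (forall (G : digraph) (S : {set {set G * G}}),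
     scheme_of_proper_dsrg G S -> (r <= rank S)%N).

(* Main.v *)
(* A doubly regular tournament matrix T of order 2p + 1 doubles to the digraph
   with adjacency matrix A = [[T, T], [T^T, T^T]], which satisfies
   A^2 + A = p J.  With R = diag(T, T^T) and F the swap of the two halves, the
   relations I, R, R^T, F, R F, R^T F form a scheme, noncommutative because
   F R F = R^T, and A A^T separates F from R^T F, so this scheme is the closure
   of A.  Transitivity of Aut(A) would force transitivity of Aut(T).

   T is the Szekeres tournament on a point oo and two copies of F_p.  Its
   translations are transitive on the arcs leaving oo and on the arcs entering
   oo, so if Aut(T) were transitive then all arcs would be alike.  Two integers
   attached to an arc are compared for an arc leaving oo and an arc entering oo;
   in terms of the quartic Jacobi sum u + i w, where p = u^2 + w^2, equality
   gives w^2 = (u - 1)^2 and w^2 (u + 1) = 0, whence p = 5.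

   For the lower bound, a proper DSRG matrix A is never normal.  If the
   symmetric matrices of the adjacency algebra commute, then
   Z = A^T A - A A^T is zero, since tr(Z^2) is the trace of a commutator.  In
   rank at most 5 the only other case has classes I, R, R^T, P, Q with P, Q
   symmetric and Z = PQ - QP nonzero; then P Z + Z P = g Z with g an integer,
   and taking traces against Z shows that P and Q together fill everything off
   the diagonal. *)
Require Import Defs.
From mathcomp Require Import all_boot all_order all_algebra all_fingroup.
From mathcomp Require Import cyclic finfield.
From mathcomp Require boolp.
From mathcomp Require Import ring zify lra.

Set Implicit Arguments.
Unset Strict Implicit.
Unset Printing Implicit Defensive.

Import Order.TTheory GRing.Theory FinRing.Theory Num.Theory.

(** * Quartic cosets of a finite field and the convolutions of their signs *)

Section Szekeres.
Local Open Scope ring_scope.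

(* f and h are the sign functions of C_0 u C_1 and C_0 u C_3, where the C_i are
   the cosets of the fourth powers; f * h is then the quadratic character and
   u + i w is the Jacobi sum of a quartic character with itself. *)
Record szekeres_pair (F : finFieldType) (f h : F -> int) (u w : int) : Prop :=
  SzekeresPair {
  sz_fN : forall x, f (- x) = - f x;
  sz_hN : forall x, h (- x) = - h x;
  sz_f2 : forall x, f x ^+ 2 = (x != 0)%:R;
  sz_h2 : forall x, h x ^+ 2 = (x != 0)%:R;
  sz_ff : forall x,
    \sum_y f y * f (x - y) = 1 + w * (f x * h x) - #|F|%:R * (x == 0)%:R;
  sz_hh : forall x,
    \sum_y h y * h (x - y) = 1 - w * (f x * h x) - #|F|%:R * (x == 0)%:R;
  sz_fh : forall x, \sum_y f y * h (x - y) = u * (f x * h x)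
}.

(** Every nonzero x has x^(2m) equal to 1 or -1; if -1 never occurred, X^(2m) - 1 would have 4m
    roots. *)
Lemma exists_expr_eqN1 (F : finFieldType) (m : nat) :
  (0 < m)%N -> #|F| = (4 * m)%N.+1 -> exists g : F, g ^+ (2 * m) = -1.
Proof.
move=> m_gt0 cardF.
have x4m (x : F) : x != 0 -> x ^+ (2 * m) = 1 \/ x ^+ (2 * m) = -1.
  move=> x0; have e : (x ^+ (2 * m)) ^+ 2 = 1.
    rewrite -exprM; apply: (mulfI x0); rewrite -exprS mulr1.
    by rewrite (_ : (2 * m * 2)%N.+1 = #|F|); [exact: expf_card | rewrite cardF; lia].
  by move/eqP: e; rewrite sqrf_eq1 => /orP[] /eqP; [left | right].
have [/existsP[g /eqP eg]|] := boolP [exists g : F, g ^+ (2 * m) == -1].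
  by exists g.
rewrite negb_exists => /forallP noN1; exfalso.
pose rs := enum (predC1 (0 : F)).
have size_rs : size rs = (4 * m)%N by rewrite -cardE cardC1 cardF.
have : (size rs <= 2 * m)%N.
  apply: max_unity_roots; first by lia.
    apply/allP => x; rewrite mem_enum /= => x0; rewrite unity_rootE.
    by have := noN1 x; case: (x4m x x0) => ->; rewrite eqxx.
  exact: enum_uniq.
by rewrite size_rs; lia.
Qed.

Lemma eq_opp_eq0 (a : int) : a = - a -> a = 0.
Proof. by lia. Qed.

Lemma sum_odd0 (F : finFieldType) (c : F -> int) :
  (forall x, c (- x) = - c x) -> \sum_x c x = 0.
Proof.
move=> cN; apply: eq_opp_eq0.
rewrite {1}(reindex_inj (inv_inj (@opprK F))) /= -sumrN.
by apply: eq_bigr => x _; rewrite cN.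
Qed.

(** One has f(gx) = h(x) and h(gx) = -f(x), while scaling by a fourth power fixes both f and h. Each
    convolution is therefore known from its value at 1, and summing over the field relates f * f and
    h * h there. *)
Lemma szekeres_pair_exists (F : finFieldType) (m : nat) :
  odd m -> #|F| = (4 * m)%N.+1 -> exists f h u w, @szekeres_pair F f h u w.
Proof.
move=> odd_m cardF.
have m_gt0 : (0 < m)%N by case: (m) odd_m.
have [g gN1] := exists_expr_eqN1 m_gt0 cardF.
(* The cosets of the fourth powers are the fibres of x |-> x ^+ m, whose
   nonzero values are 1, i, -1, -i; multiplication by g permutes them. *)
pose i := g ^+ m.
have i2 : i ^+ 2 = -1 by rewrite /i -exprM mulnC.
have char2 : (2%:R : F) != 0.
  (* The number 4m + 1 of elements vanishes in F, whereas 2 = 0 would make it 1. *)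
  apply/eqP => two0.
  have : ((4 * m)%N.+1%:R : F) = 0 by rewrite -cardF -zmodXgE -cardsT expg_cardG ?inE.
  by rewrite -addn1 natrD -[4%N]/(2 * 2)%N -mulnA natrM two0 mul0r add0r => /eqP; rewrite oner_eq0.
have N11 : (-1 == 1 :> F) = false.
  by apply/negbTE; apply: contra char2 => /eqP e; rewrite -[2%:R]/(1 + 1) -{2}e subrr.
have i1 : (i == 1) = false.
  by apply/eqP => e; move: i2; rewrite e expr1n => /esym/eqP; rewrite N11.
have iN1 : (i == -1) = false.
  by apply/eqP => e; move: i2; rewrite e sqrrN expr1n => /esym/eqP; rewrite N11.
have i0 : i != 0.
  by apply/eqP => e; move: i2; rewrite e expr0n => /esym/eqP; rewrite oppr_eq0 oner_eq0.
have iNi : (i == - i) = false.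
  by rewrite -addr_eq0 -mulr2n -mulr_natr mulf_eq0 (negbTE i0) (negbTE char2).
have g0 : g != 0 by apply: contraNneq i0 => e; rewrite /i e expr0n; case: (m) m_gt0.
pose f (x : F) : int :=
  if x == 0 then 0 else if (x ^+ m == 1) || (x ^+ m == i) then 1 else -1.
pose h (x : F) : int :=
  if x == 0 then 0 else if (x ^+ m == 1) || (x ^+ m == - i) then 1 else -1.
have xm x : x != 0 -> [\/ x ^+ m = 1, x ^+ m = i, x ^+ m = -1 | x ^+ m = - i].
  move=> x0; have e : (x ^+ m) ^+ 4 = 1.
    apply: (mulfI x0); rewrite mulr1 -exprM -exprS.
    by rewrite (_ : (m * 4)%N.+1 = #|F|); [exact: expf_card | rewrite cardF; lia].
  have : (x ^+ m - 1) * (x ^+ m - i) * ((x ^+ m + 1) * (x ^+ m + i)) = 0.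
    transitivity (((x ^+ m) ^+ 2 - 1) * ((x ^+ m) ^+ 2 - i ^+ 2)); first by ring.
    by rewrite i2; transitivity ((x ^+ m) ^+ 4 - 1); [ring | rewrite e subrr].
  move/eqP; rewrite !mulf_eq0 !subr_eq0 !addr_eq0.
  by case/orP => /orP[] /eqP; [constructor 1|constructor 2|constructor 3|constructor 4].
have oneNi : (1 == - i) = false by rewrite eq_sym eqr_oppLR iN1.
have N1i : (-1 == i) = false by rewrite eq_sym iN1.
have N1Ni : (-1 == - i) = false by rewrite eqr_opp eq_sym i1.
have Nii : (- i == i) = false by rewrite eq_sym iNi.
have Ni1 : (- i == 1) = false by rewrite eq_sym oneNi.
(* Oddness of m, that is [#|F|] = 5 mod 8, puts -1 into the coset C_2, and this makes f and h
   odd. *)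
have Nm1 : (-1 : F) ^+ m = -1 by rewrite -signr_odd odd_m expr1.
have simps := (N11, i1, iN1, iNi, oneNi, N1i, N1Ni, Nii, Ni1, eqxx, orbT).
have f0 : f 0 = 0 by rewrite /f eqxx.
have h0 : h 0 = 0 by rewrite /h eqxx.
have fN x : f (- x) = - f x.
  have [->|x0] := eqVneq x 0; first by rewrite oppr0 f0.
  rewrite /f oppr_eq0 (negbTE x0) exprNn Nm1 mulN1r.
  by case: (xm x x0) => ->; rewrite ?opprK ?simps.
have hN x : h (- x) = - h x.
  have [->|x0] := eqVneq x 0; first by rewrite oppr0 h0.
  rewrite /h oppr_eq0 (negbTE x0) exprNn Nm1 mulN1r.
  by case: (xm x x0) => ->; rewrite ?opprK ?simps.
have fg x : f (g * x) = h x.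
  have [->|x0] := eqVneq x 0; first by rewrite mulr0 f0 h0.
  rewrite /f /h mulf_eq0 (negbTE x0) (negbTE g0) exprMn -/i /=.
  by case: (xm x x0) => ->; rewrite ?mulr1 ?mulrN1 ?mulrN -?expr2 ?i2 ?opprK ?simps.
have hg x : h (g * x) = - f x.
  have [->|x0] := eqVneq x 0; first by rewrite mulr0 f0 h0.
  rewrite /f /h mulf_eq0 (negbTE x0) (negbTE g0) exprMn -/i /=.
  by case: (xm x x0) => ->; rewrite ?mulr1 ?mulrN1 ?mulrN -?expr2 ?i2 ?opprK ?simps.
have fc c x : c ^+ m = 1 -> f (c * x) = f x.
  move=> c1; have c0 : c == 0 = false.
    by apply/eqP => e; move: c1; rewrite e expr0n gtn_eqF // => /eqP;
  rewrite (eq_sym _ 1) oner_eq0.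
  by rewrite /f mulf_eq0 c0 exprMn c1 mul1r.
have hc c x : c ^+ m = 1 -> h (c * x) = h x.
  move=> c1; have c0 : c == 0 = false.
    by apply/eqP => e; move: c1; rewrite e expr0n gtn_eqF // => /eqP;
  rewrite (eq_sym _ 1) oner_eq0.
  by rewrite /h mulf_eq0 c0 exprMn c1 mul1r.
have f2 x : f x ^+ 2 = (x != 0)%:R by rewrite /f; case: eqP => //= _; case: ifP.
have h2 x : h x ^+ 2 = (x != 0)%:R by rewrite /h; case: eqP => //= _; case: ifP.
have coset x : x != 0 -> exists c, c ^+ m = 1 /\
    [\/ x = c, x = g * c, x = g * (g * c) | x = g * (g * (g * c))].
  move=> x0.
  have gm j : (x / g ^+ j) ^+ m = x ^+ m / i ^+ j.
    by rewrite exprMn exprVn /i -!exprM mulnC.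
  have gx j : x = g ^+ j * (x / g ^+ j) by rewrite mulrC divfK // expf_neq0.
  case: (xm x x0) => e.
  - by exists x; split => //; constructor 1.
  - exists (x / g ^+ 1); rewrite gm e divff //; split=> //.
    by constructor 2; rewrite {1}(gx 1%N) expr1.
  - exists (x / g ^+ 2); rewrite gm e i2 divff ?oppr_eq0 ?oner_eq0 //; split=> //.
    by constructor 3; rewrite {1}(gx 2%N); move: (x / _) => c; rewrite expr2 -mulrA.
  - exists (x / g ^+ 3); rewrite gm e exprS i2 mulrN1 divff ?oppr_eq0 //; split=> //.
    by constructor 4; rewrite {1}(gx 3%N); move: (x / _) => c; rewrite !exprS expr0 mulr1 !mulrA.
pose cv (a b : F -> int) x := \sum_y a y * b (x - y).
have cvZ (k : F) (a b a' b' : F -> int) x : k != 0 ->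
    (forall y, a (k * y) = a' y) -> (forall y, b (k * y) = b' y) ->
    cv a b (k * x) = cv a' b' x.
  move=> k0 ha hb; rewrite /cv (reindex_inj (mulfI k0)) /=.
  by apply: eq_bigr => y _; rewrite ha -mulrBr hb.
have cvC a b x : cv a b x = cv b a x.
  rewrite /cv (reindex_inj (inv_inj (subKr x))) /=.
  by apply: eq_bigr => y _; rewrite subKr mulrC.
have c0 (c : F) : c ^+ m = 1 -> c != 0.
  by move=> c1; apply/eqP => e; move: c1; rewrite e expr0n gtn_eqF // => /eqP;
  rewrite (eq_sym _ 1) oner_eq0.
have cvN (a b : F -> int) x : cv (fun y => - a y) b x = - cv a b x.
  by rewrite /cv -sumrN; apply: eq_bigr => y _; rewrite mulNr.
have cvNr (a b : F -> int) x : cv a (fun y => - b y) x = - cv a b x.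
  by rewrite /cv -sumrN; apply: eq_bigr => y _; rewrite mulrN.
have fh_g x : cv f h (g * x) = - cv f h x.
  by rewrite (cvZ g f h h (fun y => - f y)) // cvNr cvC.
have ff_g x : cv f f (g * x) = cv h h x by rewrite (cvZ g f f h h).
have hh_g x : cv h h (g * x) = cv f f x.
  by rewrite (cvZ g h h (fun y => - f y) (fun y => - f y)) // cvN cvNr opprK.
have cv1 (c : F) : c ^+ m = 1 ->
    [/\ cv f h c = cv f h 1, cv f f c = cv f f 1 & cv h h c = cv h h 1].
  move=> c1; have cn0 := c0 c c1; rewrite -[c]mulr1.
  by split; apply: cvZ => // y; rewrite ?fc ?hc.
have f1 (c : F) : c ^+ m = 1 -> f c = 1.
  by move=> c1; rewrite -[c]mulr1 fc // /f oner_eq0 expr1n eqxx.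
have h1 (c : F) : c ^+ m = 1 -> h c = 1.
  by move=> c1; rewrite -[c]mulr1 hc // /h oner_eq0 expr1n eqxx.
have chi_g x : f (g * x) * h (g * x) = - (f x * h x) by rewrite fg hg mulrN mulrC.
have cv00 (a b : F -> int) : (forall y, b (- y) = - b y) -> cv a b 0 = - \sum_y a y * b y.
  by move=> bN; rewrite /cv -sumrN; apply: eq_bigr => y _; rewrite sub0r bN mulrN.
have sumneq0 : \sum_(x : F) ((x != 0)%:R : int) = (4 * m)%:R.
  rewrite (bigD1 0) //= eqxx add0r (eq_bigr (fun=> 1)) => [|x ->] //.
  rewrite sumr_const; congr (1 *+ _).
  by rewrite (_ : #|_| = #|predC1 (0 : F)|) ?cardC1 ?cardF //; apply: eq_card.
have sum_chi : \sum_y f y * h y = 0.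
  apply: eq_opp_eq0; rewrite {1}(reindex_inj (mulfI g0)) /= -sumrN.
  by apply: eq_bigr => x _; rewrite chi_g.
have sum_cv (a b : F -> int) : \sum_x a x = 0 -> \sum_x cv a b x = 0.
  move=> a0; rewrite /cv exchange_big /=.
  transitivity (\sum_y a y * \sum_x b x).
    apply: eq_bigr => y _; rewrite -mulr_sumr; congr (_ * _).
    by rewrite (reindex_inj (addIr y)) /=; apply: eq_bigr => x _; rewrite addrK.
  by rewrite -mulr_suml a0 mul0r.
have ff0 : cv f f 0 = - (4 * m)%:R.
  by rewrite cv00 // -sumneq0; congr (- _); apply: eq_bigr => y _; rewrite -expr2 f2.
have hh0 : cv h h 0 = - (4 * m)%:R.
  by rewrite cv00 // -sumneq0; congr (- _); apply: eq_bigr => y _; rewrite -expr2 h2.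
(* The sum f * f + h * h has total zero over the field, equals -8m at 0 and is constant on the 4m
   nonzero points, so that constant is 2. *)
have sumffhh : cv f f 1 + cv h h 1 = 2.
  have e : \sum_x (cv f f x + cv h h x) = 0.
    by rewrite big_split /= !sum_cv ?addr0 //; apply: sum_odd0.
  have e2 x : x != 0 -> cv f f x + cv h h x = cv f f 1 + cv h h 1.
    move=> /coset[c [c1 cx]]; have [_ eff ehh] := cv1 c c1.
    by case: cx => ->; rewrite ?(ff_g, hh_g) eff ehh // addrC.
  move: e; rewrite (bigD1 0) //= (eq_bigr (fun=> cv f f 1 + cv h h 1)) //.
  rewrite ff0 hh0 sumr_const.
  have -> : #|[pred x : F | x != 0]| = (4 * m)%N.
    by rewrite (_ : #|_| = #|predC1 (0 : F)|) ?cardC1 ?cardF //; apply: eq_card.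
  rewrite -mulr_natr => e.
  have : ((4 * m)%:R : int) * (cv f f 1 + cv h h 1 - 2) = 0 by rewrite -[RHS]e; ring.
  move/eqP; rewrite mulf_eq0 pnatr_eq0 muln_eq0 /= eqn0Ngt m_gt0 /= subr_eq0.
  by move/eqP.
(* u is the value of f * h at 1, and w the deviation of f * f at 1 from the common mean 1 of f * f
   and h * h. *)
exists f, h, (cv f h 1), (cv f f 1 - 1); split=> // x; rewrite -/(cv _ _ x).
- have [->|x0] := eqVneq x 0.
    by rewrite ff0 f0 cardF mul0r mulr0 addr0 mulr1n mulr1 mulrS opprD addrA subrr add0r.
  rewrite mulr0n mulr0 subr0; case: (coset x x0) => c [c1 cx]; have [_ eff ehh] := cv1 c c1.
  have hh1 : cv h h 1 = 1 - (cv f f 1 - 1).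
    by apply/eqP; rewrite opprB addrA eq_sym subr_eq addrC; apply/eqP.
  by case: cx => ->; rewrite ?(ff_g, hh_g, fg, hg) ?eff ?ehh ?f1 ?h1 // ?hh1; ring.
- have [->|x0] := eqVneq x 0.
    by rewrite hh0 f0 cardF mul0r mulr0 subr0 mulr1n mulr1 mulrS opprD addrA subrr add0r.
  rewrite mulr0n mulr0 subr0; case: (coset x x0) => c [c1 cx]; have [_ eff ehh] := cv1 c c1.
  have hh1 : cv h h 1 = 1 - (cv f f 1 - 1).
    by apply/eqP; rewrite opprB addrA eq_sym subr_eq addrC; apply/eqP.
  by case: cx => ->; rewrite ?(ff_g, hh_g, fg, hg) ?eff ?ehh ?f1 ?h1 // ?hh1; ring.
- have [->|x0] := eqVneq x 0; first by rewrite cv00 // sum_chi f0 mul0r mulr0 oppr0.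
  case: (coset x x0) => c [c1 cx]; have [efh _ _] := cv1 c c1.
  by case: cx => ->; rewrite ?fh_g ?(fg, hg) ?efh ?f1 ?h1 //; ring.
Qed.

End Szekeres.

(** * The sign matrix of the Szekeres tournament *)

Section SzekeresSigns.
Local Open Scope ring_scope.

Lemma big_option_bool (F : finType) (c : option (F * bool) -> int) :
  \sum_v c v = c None + \sum_x c (Some (x, false)) + \sum_x c (Some (x, true)).
Proof.
rewrite (bigD1 None) //= -addrA; congr (_ + _).
rewrite (reindex_omap Some id) => [|[]//] /=.
rewrite (eq_bigl (fun i : F * bool => true)) => [|i]; last by rewrite eqxx.
transitivity (\sum_(x : F) \sum_(b : bool) c (Some (x, b))).
  by rewrite pair_big; apply: eq_bigr => -[x b].
by rewrite -big_split /=; apply: eq_bigr => x _; rewrite big_bool addrC.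
Qed.

Variables (F : finFieldType) (f h : F -> int) (u w : int).
Hypothesis sz : szekeres_pair f h u w.

Let chi x := f x * h x.
Let dl (x : F) : int := (x == 0)%:R.
Let p : int := #|F|%:R.
(** This is the block from the first copy to the second; the delta fills the zero of -h at 0, so
    that every entry is a sign. *)
Let kap x := - h x + dl x.
Let cv (a b : F -> int) x := \sum_y a y * b (x - y).

Let fN := sz_fN sz.
Let hN := sz_hN sz.

Let f0 : f 0 = 0. Proof. by apply: eq_opp_eq0; rewrite -fN oppr0. Qed.
Let h0 : h 0 = 0. Proof. by apply: eq_opp_eq0; rewrite -hN oppr0. Qed.

Let dlN x : dl (- x) = dl x. Proof. by rewrite /dl oppr_eq0. Qed.
Let chiN x : chi (- x) = chi x. Proof. by rewrite /chi fN hN mulrNN. Qed.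

(** In each of these five patterns a polynomial in f, h and [dl] is a constant, so pointwise
    identities reduce to [ring]. *)
Let sq x : [/\ f x = 0, h x = 0 & dl x = 1] \/
  [\/ [/\ f x = 1, h x = 1 & dl x = 0], [/\ f x = 1, h x = -1 & dl x = 0],
     [/\ f x = -1, h x = 1 & dl x = 0] | [/\ f x = -1, h x = -1 & dl x = 0]].
Proof.
have [->|x0] := eqVneq x 0.
  by rewrite f0 h0 /dl eqxx; left.
right; have /eqP := sz_f2 sz x; have /eqP := sz_h2 sz x; rewrite /dl (negbTE x0) !sqrf_eq1.
case/orP => /eqP ->; case/orP => /eqP ->.
- by constructor 1.
- by constructor 3.
- by constructor 2.
by constructor 4.
Qed.

Let cvC a b x : cv a b x = cv b a x.
Proof.
rewrite /cv (reindex_inj (inv_inj (subKr x))) /=.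
by apply: eq_bigr => y _; rewrite subKr mulrC.
Qed.

Let cv_dl b x : cv dl b x = b x.
Proof.
rewrite /cv (bigD1 0) //= {1}/dl eqxx mul1r subr0 big1 ?addr0 // => y y0.
by rewrite /dl (negbTE y0) mul0r.
Qed.

Let cv_shift (a b : F -> int) x y : \sum_z a (z - x) * b (y - z) = cv a b (y - x).
Proof.
rewrite (reindex_inj (addIr x)) /=; apply: eq_bigr => z _.
by congr (a _ * b _); ring.
Qed.

Let cvD a b c x : cv a (fun y => b y + c y) x = cv a b x + cv a c x.
Proof. by rewrite /cv -big_split; apply: eq_bigr => y _; rewrite mulrDr. Qed.

Let cvN a b x : cv a (fun y => - b y) x = - cv a b x.
Proof. by rewrite /cv -sumrN; apply: eq_bigr => y _; rewrite mulrN. Qed.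

Let ff x : cv f f x = 1 + w * chi x - p * dl x. Proof. exact: (sz_ff sz). Qed.
Let hh x : cv h h x = 1 - w * chi x - p * dl x. Proof. exact: (sz_hh sz). Qed.
Let fh x : cv f h x = u * chi x. Proof. exact: (sz_fh sz). Qed.

Let cv_kap a x : cv a kap x = - cv a h x + a x.
Proof. by rewrite cvD cvN (cvC a dl) cv_dl. Qed.

Let fk x : cv f kap x = - (u * chi x) + f x.
Proof. by rewrite cv_kap fh. Qed.

Let kapN x : kap (- x) = h x + dl x. Proof. by rewrite /kap hN opprK dlN. Qed.

Let kk x : cv kap (fun y => kap (- y)) x = - (1 - w * chi x - p * dl x) + dl x.
Proof.
transitivity (cv kap (fun y => h y + dl y) x).
  by apply: eq_bigr => y _; rewrite kapN.
rewrite cvD (cvC kap h) cv_kap (cvC kap dl) cv_dl hh /kap; ring.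
Qed.

Let fp (a : F -> int) x : cv a (fun y => f (- y)) x = - cv a f x.
Proof. by rewrite -cvN; apply: eq_bigr => y _; rewrite fN. Qed.

(* None is the extra point oo; the second copy carries the reversed circulant. *)
Definition szekeres_sign (x y : option (F * bool)) : int :=
  match x, y with
  | None, None => 0
  | None, Some (_, b) => if b then -1 else 1
  | Some (_, a), None => if a then 1 else -1
  | Some (x, false), Some (y, false) => f (y - x)
  | Some (x, true), Some (y, true) => f (x - y)
  | Some (x, false), Some (y, true) => - h (y - x) + (y - x == 0)%:R
  | Some (x, true), Some (y, false) => h (x - y) - (x - y == 0)%:R
  end.
Local Notation s := szekeres_sign.

Let inj (b : bool) (a c : F) : (Some (a, b) == Some (c, b)) = (a == c).
Proof. by apply/eqP/eqP => [[]|->]. Qed.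

Let n0 (a c : F) : ((Some (a, true) == Some (c, false)) = false) *
                   ((Some (a, false) == Some (c, true)) = false).
Proof. by split; apply/eqP => -[]. Qed.

Lemma szekeres_sign_anti x y : s y x = - s x y.
Proof.
case: x y => [[x []]|] [[y []]|] //=; first by rewrite -fN opprB.
- by rewrite opprB addrC.
- by rewrite opprD opprK.
- by rewrite -fN opprB.
Qed.

Lemma szekeres_sign_sq x y : s x y ^+ 2 = (x != y)%:R.
Proof.
case: x y => [[x []]|] [[y []]|] //=.
- by rewrite (sz_f2 sz) subr_eq0 inj.
- by rewrite n0; case: (sq (x - y)) => [|[]] -[_]; rewrite /dl => -> ->.
- by rewrite n0; case: (sq (y - x)) => [|[]] -[_]; rewrite /dl => -> ->.
- by rewrite (sz_f2 sz) subr_eq0 inj eq_sym.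
Qed.

Let sum_shift (a : F -> int) x : \sum_z a (z - x) = \sum_z a z.
Proof. by rewrite (reindex_inj (addIr x)) /=; apply: eq_bigr => z _; rewrite addrK. Qed.

Let sum_flip (a : F -> int) x : \sum_z a (x - z) = \sum_z a z.
Proof. by rewrite (reindex_inj (inv_inj (subKr x))) /=; apply: eq_bigr => z _; rewrite subKr. Qed.

Let sum_f : \sum_z f z = 0. Proof. exact: sum_odd0. Qed.
Let sum_h : \sum_z h z = 0. Proof. exact: sum_odd0. Qed.
Let sum_dl : \sum_z dl z = 1.
Proof.
by rewrite (bigD1 0) //= {1}/dl eqxx big1 ?addr0 // => y y0; rewrite /dl (negbTE y0).
Qed.
Let sum_kap : \sum_z kap z = 1.
Proof. by rewrite big_split /= sumrN sum_h sum_dl oppr0 add0r. Qed.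

Lemma szekeres_sign_sum x : \sum_z s x z = 0.
Proof.
rewrite big_option_bool; case: x => [[x []]|] /=.
- rewrite (sum_flip f) sum_f addr0.
  rewrite (eq_bigr (fun z => - kap (x - z))) => [|z _]; last by rewrite /kap opprD opprK.
  by rewrite sumrN (sum_flip kap) sum_kap subrr.
- by rewrite (sum_shift f) sum_f (sum_shift kap) sum_kap.
- by rewrite add0r -big_split big1.
Qed.

(** Inside a copy the two blocks contribute -(f * f) and the autocorrelation of [kap], whose terms
    in w cancel to leave -2 off the diagonal; the column oo adds 1. Between the copies the two block
    sums cancel and oo contributes -1. *)
Lemma szekeres_sign_gram x y :
  \sum_z s x z * s y z = (2 * p + 1) * (x == y)%:R - 1.
Proof.
have sc : \sum_(z : F) (1 : int) = p by rewrite sumr_const.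
rewrite big_option_bool; case: x y => [[x []]|] [[y []]|] /=.
- rewrite inj [X in _ + _ + X](_ : _ = - cv f f (y - x)).
    rewrite [X in _ + X + _](_ : _ = cv kap (fun y => kap (- y)) (y - x)).
      by rewrite kk ff /dl subr_eq0 eq_sym; ring.
    (* Rows of the second copy are functions of x - z; the reflection z |-> x + y - z turns their
       products into a convolution at y - x. *)
    rewrite -(cv_shift kap (fun y => kap (- y))) (reindex_inj (inv_inj (subKr (x + y)))) /=.
    apply: eq_bigr => z _; rewrite (_ : x - _ = z - y); last by ring.
    rewrite (_ : - (y - z) = z - y); last by ring.
    by rewrite (_ : y - _ = z - x) /kap /dl; ring.
  rewrite -fp -(cv_shift f (fun y => f (- y))) (reindex_inj (inv_inj (subKr (x + y)))) /=.
  by apply: eq_bigr => z _; rewrite mulrC; congr (f _ * f _); ring.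
- rewrite n0 mulr0 [X in _ + X + _](_ : _ = - cv f kap (x - y)).
    rewrite [X in _ + X](_ : _ = cv f kap (x - y)); first by ring.
    rewrite -cv_shift (reindex_inj (inv_inj (subKr (x + y)))) /=.
    apply: eq_bigr => z _; rewrite (_ : x - _ = z - y); last by ring.
    by rewrite (_ : x + y - z - y = x - z) /kap /dl; ring.
  rewrite -cv_shift -sumrN; apply: eq_bigr => z _; rewrite /kap /dl; ring.
- rewrite mulr0 add0r (eq_bigr (fun z => - kap (x - z))) => [|z _]; last by rewrite /kap /dl; ring.
  by rewrite sumrN (sum_flip kap) sum_kap -mulr_suml (sum_flip f) sum_f; ring.
- rewrite n0 mulr0 [X in _ + X + _](_ : _ = - cv f kap (y - x)).
    rewrite [X in _ + X](_ : _ = cv f kap (y - x)); first by ring.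
    rewrite -cv_shift (reindex_inj (inv_inj (subKr (x + y)))) /=.
    apply: eq_bigr => z _; rewrite (_ : y - _ = z - x); last by ring.
    by rewrite (_ : x + y - z - x = y - z) /kap /dl; ring.
  rewrite -cv_shift -sumrN; apply: eq_bigr => z _; rewrite /kap /dl; ring.
- rewrite inj [X in _ + X + _](_ : _ = - cv f f (y - x)).
    rewrite [X in _ + X](_ : _ = cv kap (fun y => kap (- y)) (y - x)).
      by rewrite kk ff /dl subr_eq0 eq_sym; ring.
    rewrite -(cv_shift kap (fun y => kap (- y))) /=.
    by apply: eq_bigr => z _; rewrite opprB /kap /dl; ring.
  rewrite -fp -(cv_shift f (fun y => f (- y))) /=.
  by apply: eq_bigr => z _; rewrite opprB.
- rewrite mulr0 add0r (eq_bigr (fun z => f (z - x))) => [|z _]; last by ring.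
  rewrite (sum_shift f) sum_f -mulr_suml; rewrite [X in X * _](_ : _ = 1); first by ring.
  exact: etrans (sum_shift kap x) sum_kap.
- rewrite mul0r add0r (eq_bigr (fun z => - kap (y - z))) => [|z _]; last by rewrite /kap /dl; ring.
  by rewrite sumrN (sum_flip kap) sum_kap -mulr_sumr (sum_flip f) sum_f; ring.
- rewrite mul0r add0r (eq_bigr (fun z => f (z - y))) => [|z _]; last by ring.
  rewrite (sum_shift f) sum_f -mulr_sumr; rewrite [X in _ * X](_ : _ = 1); first by ring.
  exact: etrans (sum_shift kap y) sum_kap.
- by rewrite mul0r !mulrNN !mulr1 sc; ring.
Qed.



(** * Products of three rows and the two arc invariants *)

Definition triple_sign x y z := \sum_v s x v * s y v * s z v.
Local Notation t := triple_sign.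

(** The Gram entries of distinct rows all agree and distinguish nothing, hence the passage to three
    rows. In the names, 0 stands for the arc from oo to 0 in the first copy, 1 for the arc from 0 in
    the second copy to oo, and the last letter for the copy containing the third vertex. *)
Let t0f z : t None (Some (0, false)) (Some (z, false)) = - (2 * w * chi z) - dl z.
Proof.
rewrite /t big_option_bool /= !mul0r add0r.
rewrite [X in X + _](_ : _ = - cv f f (0 - z)); last first.
  rewrite -fp -(cv_shift f (fun y => f (- y)) z 0); apply: eq_bigr => y _.
  by rewrite mul1r mulrC; congr (_ * f _); ring.
rewrite [X in _ + X](_ : _ = - cv kap (fun y => kap (- y)) (0 - z)); last first.
  rewrite -(cv_shift kap (fun y => kap (- y)) z 0) -sumrN; apply: eq_bigr => y _.
  rewrite (_ : - (0 - y) = y - 0); last by ring.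
  by rewrite /kap /dl; ring.
by rewrite kk ff sub0r dlN chiN; ring.
Qed.

Let t0t z : t None (Some (0, false)) (Some (z, true)) = 2 * (u * chi z - f z).
Proof.
rewrite /t big_option_bool /= !mul0r add0r.
rewrite [X in X + _](_ : _ = - cv f kap z); last first.
  rewrite -sumrN; apply: eq_bigr => y _; rewrite subr0 /kap /dl; ring.
rewrite [X in _ + X](_ : _ = - cv kap f z); last first.
  rewrite -sumrN; apply: eq_bigr => y _; rewrite subr0 /kap /dl; ring.
by rewrite (cvC kap) fk; ring.
Qed.

Let t1f z : t (Some (0, true)) None (Some (z, false)) = 2 * (u * chi z + f z).
Proof.
rewrite /t big_option_bool /= mulr0 mul0r add0r.
rewrite [X in X + _](_ : _ = - cv f kap (0 - z)); last first.
  rewrite -cv_shift -sumrN; apply: eq_bigr => y _; rewrite /kap /dl; ring.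
rewrite [X in _ + X](_ : _ = - cv kap f (0 - z)); last first.
  rewrite -cv_shift -sumrN; apply: eq_bigr => y _; rewrite /kap /dl; ring.
by rewrite (cvC kap) fk sub0r chiN fN; ring.
Qed.

Let t1t z : t (Some (0, true)) None (Some (z, true)) = 2 * w * chi z + dl z.
Proof.
rewrite /t big_option_bool /= mulr0 mul0r add0r.
rewrite [X in X + _](_ : _ = cv kap (fun y => kap (- y)) (0 - z)); last first.
  rewrite -(cv_shift kap (fun y => kap (- y)) z 0) (reindex_inj (inv_inj (subKr (0 + z)))) /=.
  apply: eq_bigr => y _.
  have -> : 0 - (0 + z - y) = y - z by ring.
  have -> : z - (0 + z - y) = y by ring.
  have -> : - (0 - y) = y by ring.
  by rewrite /kap /dl; ring.
rewrite [X in _ + X](_ : _ = cv f f (0 - z)); last first.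
  rewrite -[RHS]opprK -fp -(cv_shift f (fun y => f (- y)) z 0).
  rewrite (reindex_inj (inv_inj (subKr (0 + z)))) /=.
  rewrite -sumrN; apply: eq_bigr => y _.
  have -> : 0 - (0 + z - y) = y - z by ring.
  have -> : z - (0 + z - y) = y by ring.
  have -> : - (0 - y) = y by ring.
  by ring.
by rewrite kk ff sub0r dlN chiN; ring.
Qed.

Let sum_chi : \sum_z chi z = 0.
Proof.
have : cv f h 0 = 0 by rewrite fh /chi f0 mul0r mulr0.
rewrite /cv => /eqP; rewrite -oppr_eq0 -sumrN => /eqP e; rewrite -[RHS]e.
by apply: eq_bigr => y _; rewrite sub0r hN mulrN opprK.
Qed.

(** f, h and [chi] all sum to zero. Most of the sums below come down to this, since [sq] verifies
    that their summands are of this linear form. *)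
Let sum_lin (a b c d e : int) (k : F -> int) :
  (forall z, k z = a + b * f z + c * h z + d * chi z + e * dl z) ->
  \sum_z k z = a * p + e.
Proof.
move=> kE; rewrite (eq_bigr _ (fun z _ => kE z)) !big_split /= -!mulr_sumr.
by rewrite sum_f sum_h sum_chi sum_dl sumr_const -mulr_natr; ring.
Qed.

(** This is the norm of the Jacobi sum. The squared norm of f * h is u^2 (p - 1) directly;
    reassociating it as - <f, f * (h * h)> and inserting the formula for h * h gives (p - w^2)(p -
    1). *)
Lemma szekeres_card : p = u ^+ 2 + w ^+ 2.
Proof.
have p1 : p - 1 != 0.
  by rewrite /p subr_eq0 (eqr_nat int _ 1) gtn_eqF // card_finNzRing_gt1.
(* Oddness of f moves the convolution from [chi] onto f * f. *)
have fchi : \sum_y f y * cv f chi y = - w * (p - 1).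
  transitivity (\sum_z - chi z * cv f f z).
    rewrite /cv; under eq_bigr do rewrite -/(cv f chi _) cvC mulr_sumr.
    rewrite exchange_big /=; apply: eq_bigr => z _.
    rewrite mulr_sumr; apply: eq_bigr => y _.
    by rewrite -[z - y]opprB fN; ring.
  rewrite (@sum_lin (- w) 0 0 (-1) w); first by ring.
  by move=> z; rewrite ff /chi; case: (sq z) => [|[]] -[-> -> ->]; ring.
have fhh y : cv f (cv h h) y = \sum_x h (y - x) * cv f h x.
  rewrite {1}/cv.
  under eq_bigr => z _ do rewrite -(cv_shift h h z y) mulr_sumr.
  rewrite exchange_big /=; apply: eq_bigr => x _; rewrite mulr_sumr.
  by apply: eq_bigr => z _; ring.
apply: (mulIf p1); rewrite mulrDl.
have -> : u ^+ 2 * (p - 1) = \sum_x cv f h x * cv f h x.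
  rewrite (@sum_lin (u ^+ 2) 0 0 0 (- u ^+ 2)); first by ring.
  by move=> z; rewrite fh /chi; case: (sq z) => [|[]] -[-> -> ->]; ring.
have -> : \sum_x cv f h x * cv f h x = - \sum_y f y * cv f (cv h h) y.
  rewrite -sumrN; under [RHS]eq_bigr do rewrite fhh mulr_sumr -sumrN.
  rewrite exchange_big /=; apply: eq_bigr => x _; rewrite {1}/cv mulr_suml.
  by apply: eq_bigr => y _; rewrite -[y - x]opprB hN; ring.
have -> : \sum_y f y * cv f (cv h h) y =
    \sum_y f y * (- w * cv f chi y - p * f y).
  apply: eq_bigr => y _; congr (_ * _); rewrite {1}/cv.
  under eq_bigr do rewrite hh.
  transitivity (\sum_z f z - w * cv f chi y - p * cv f dl y).
    by rewrite /cv !mulr_sumr -!sumrB; apply: eq_bigr => z _; ring.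
  by rewrite sum_f (cvC f dl) cv_dl; ring.
transitivity (w * (\sum_y f y * cv f chi y) + p * \sum_y f y * f y + w ^+ 2 * (p - 1)); last first.
  by rewrite !mulr_sumr -big_split -sumrN; congr (_ + _); apply: eq_bigr => y _ /=; ring.
rewrite fchi (@sum_lin 1 0 0 0 (-1) (fun y => f y * f y)); first by ring.
by move=> z; rewrite /chi; case: (sq z) => [|[]] -[-> -> ->]; ring.
Qed.

(** This convolution is not evaluated pointwise; only its inner products with [chi] and f enter the
    second invariant. *)
Let chih z := cv chi h z.

Let sum_chi_chih : \sum_z chi z * chih z = 0.
Proof.
apply: sum_odd0 => z; rewrite chiN -mulrN; congr (_ * _); rewrite /chih /cv -sumrN.
rewrite (reindex_inj (inv_inj (@opprK F))) /=; apply: eq_bigr => y _.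
by rewrite chiN -mulrN -hN; congr (_ * h _); ring.
Qed.

(** Oddness of h moves the convolution onto f * h = u [chi]. *)
Let sum_f_chih : \sum_z f z * chih z = - u * (p - 1).
Proof.
transitivity (\sum_y chi y * - cv f h y).
  rewrite /chih /cv; under eq_bigr do rewrite mulr_sumr.
  rewrite exchange_big /=; apply: eq_bigr => y _.
  rewrite -sumrN mulr_sumr; apply: eq_bigr => z _.
  by rewrite -mulrN -hN opprB; ring.
rewrite (@sum_lin (- u) 0 0 0 u); first by ring.
by move=> z; rewrite fh /chi; case: (sq z) => [|[]] -[-> -> ->]; ring.
Qed.

(* As s^2 + s vanishes unless s = 1, z ranges over the vertices dominated by
   both ends of the arc. *)
Definition arc_invariant1 x y :=
  \sum_z (s x z ^+ 2 + s x z) * (s y z ^+ 2 + s y z) * t x y z ^+ 2.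

(* Here z ranges over the vertices closing a cyclic triangle with the arc and
   z' over the midpoints of the transitive triangles on it. *)
Definition arc_invariant2 x y :=
  \sum_z \sum_z' (s x z ^+ 2 - s x z) * (s y z ^+ 2 + s y z) * t x y z *
    ((s x z' ^+ 2 + s x z') * (s y z' ^+ 2 - s y z') * t x y z') * s z z'.

(** The common out-neighbours are the (p - 1)/2 points z of the first copy with f(z) = 1; each has
    weight 4 and squared triple sign 4 w^2. *)
Lemma arc_invariant1_out :
  arc_invariant1 None (Some (0, false)) = 8 * w ^+ 2 * (p - 1).
Proof.
rewrite /arc_invariant1 big_option_bool /= (_ : _ * _ = 0); last by ring.
rewrite [X in _ + X]big1 => [|z _]; last by ring.
rewrite (@sum_lin (8 * w ^+ 2) (8 * w ^+ 2) 0 0 (- 8 * w ^+ 2)); first by ring.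
by move=> z; rewrite t0f subr0 /chi; case: (sq z) => [|[]] -[-> -> ->]; ring.
Qed.

(** The common out-neighbours are the (p - 1)/2 points z of the first copy with h(z) = -1, where
    [chi] = -f makes the squared triple sign 4 (u - 1)^2. *)
Lemma arc_invariant1_in :
  arc_invariant1 (Some (0, true)) None = 8 * (u - 1) ^+ 2 * (p - 1).
Proof.
rewrite /arc_invariant1 big_option_bool /= (_ : _ * _ = 0); last by ring.
rewrite [X in _ + X]big1 => [|z _]; last by ring.
rewrite (@sum_lin (8 * (u - 1) ^+ 2) 0 (- 8 * (u - 1) ^+ 2) 0 (- 8 * (u - 1) ^+ 2)); first by ring.
move=> z; rewrite t1f sub0r hN oppr_eq0 -/(dl z) /chi.
by case: (sq z) => [|[]] -[-> -> ->]; ring.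
Qed.

(** Here z lies in the second copy with h(z) = -1 or z = 0, the triple sign vanishing at 0, and z'
    in the first copy with f(z') = -1. The factors [chi] - f and [chi] - h vanish at the other
    points and equal -2f and -2h on these supports, so they encode supports and triple signs at
    once. *)
Lemma arc_invariant2_out :
  arc_invariant2 None (Some (0, false)) = - 16 * w * (u + 1) * (p - 1) * (w + u - 1).
Proof.
rewrite /arc_invariant2 big_option_bool /= big1 => [|z _]; last by ring.
rewrite add0r [X in X + _]big1 => [|z _]; last by rewrite big1 // => z' _; ring.
transitivity (\sum_z (- 16 * w * (u + 1) * (chi z - f z) * (chih z - cv h h z - chi z + h z))).
  rewrite add0r; apply: eq_bigr => z _; rewrite big_option_bool /=.
  rewrite (_ : _ * _ * 1 = 0); last by ring.
  rewrite [X in _ + X]big1 => [|z' _]; last by ring.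
  rewrite add0r addr0 t0t subr0 -/(dl z) -/(kap z).
  transitivity (\sum_z' (- 16 * w * (u + 1) * (chi z - f z)) *
      ((chi z' - h z') * (h (z - z') - dl (z - z')))).
    apply: eq_bigr => z' _; rewrite t0f subr0 -/(dl _).
    rewrite /chi /kap.
    by case: (sq z') => [|[]] -[-> -> ->]; case: (sq z) => [|[]] -[-> -> ->]; ring.
  rewrite -mulr_sumr; congr (_ * _).
  rewrite /chih.
  have e : cv (fun y => chi y - h y) kap z = - (cv chi h z - cv h h z) + (chi z - h z).
    rewrite cv_kap (cvC _ h) cvD cvN (cvC h chi); ring.
  transitivity (- cv (fun y => chi y - h y) kap z); last by rewrite e; ring.
  by rewrite /cv -sumrN; apply: eq_bigr => y _; rewrite /kap; ring.
transitivity (- 16 * w * (u + 1) * (\sum_z chi z * chih z - \sum_z f z * chih z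
   + \sum_z (chi z - f z) * (- cv h h z - chi z + h z))).
  rewrite -sumrB -big_split mulr_sumr; apply: eq_bigr => z _ /=; ring.
rewrite sum_chi_chih sum_f_chih (@sum_lin (w - 1) 2 (1 - w) (-2) (1 - w)); first by ring.
move=> z; rewrite hh /chi; case: (sq z) => [|[]] -[-> -> ->]; ring.
Qed.

(** Now z lies in the first copy with h(z) = 1 or z = 0, and z' in the second copy with f(z') = -1;
    the factors encoding them are [chi] + f and [chi] - h. *)
Lemma arc_invariant2_in :
  arc_invariant2 (Some (0, true)) None = 16 * w * (u + 1) * (p - 1) * (w - u + 1).
Proof.
rewrite /arc_invariant2 big_option_bool /= big1 => [|z _]; last by ring.
rewrite add0r [X in _ + X]big1 => [|z _]; last by rewrite big1 // => z' _; ring.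
transitivity (\sum_z (16 * w * (u + 1) * (chi z + f z) * (chih z - cv h h z + chi z - h z))).
  rewrite addr0; apply: eq_bigr => z _; rewrite big_option_bool /=.
  rewrite (_ : _ * _ * -1 = 0); last by ring.
  rewrite [X in _ + X + _]big1 => [|z' _]; last by ring.
  rewrite !add0r t1f hN oppr_eq0 -/(dl z).
  transitivity (\sum_z' (16 * w * (u + 1) * (chi z + f z)) *
      ((chi z' - h z') * (h (z - z') + dl (z - z')))).
    apply: eq_bigr => z' _; rewrite t1t sub0r fN -[z' - z]opprB hN oppr_eq0 -/(dl _).
    rewrite /chi.
    by case: (sq z') => [|[]] -[-> -> ->]; case: (sq z) => [|[]] -[-> -> ->]; ring.
  rewrite -mulr_sumr; congr (_ * _).
  transitivity (cv (fun y => chi y - h y) (fun y => h y + dl y) z); first by [].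
  rewrite cvD (cvC _ dl) cv_dl (cvC _ h) cvD cvN (cvC h chi) /chih; ring.
transitivity (16 * w * (u + 1) * (\sum_z chi z * chih z + \sum_z f z * chih z
   + \sum_z (chi z + f z) * (- cv h h z + chi z - h z))).
  rewrite -!big_split mulr_sumr; apply: eq_bigr => z _ /=; ring.
rewrite sum_chi_chih sum_f_chih (@sum_lin (w + 1) (-2) (w + 1) (-2) (- w - 1)); first by ring.
move=> z; rewrite hh /chi; case: (sq z) => [|[]] -[-> -> ->]; ring.
Qed.


Definition szekeres_arc x y := s x y == 1.

Lemma szekeres_signE x y : s x y = (szekeres_arc x y)%:R - (szekeres_arc y x)%:R.
Proof.
rewrite /szekeres_arc (szekeres_sign_anti x y); have /eqP := szekeres_sign_sq x y.
case: (x =P y) => _ /=; first by rewrite sqrf_eq0 => /eqP ->.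
by rewrite sqrf_eq1 => /orP[] /eqP ->.
Qed.

Lemma arc_invariants_iso (r : option (F * bool) -> option (F * bool)) x y :
  injective r -> (forall a b, s (r a) (r b) = s a b) ->
  arc_invariant1 (r x) (r y) = arc_invariant1 x y /\
  arc_invariant2 (r x) (r y) = arc_invariant2 x y.
Proof.
move=> r_inj sr.
have tr a b c : t (r a) (r b) (r c) = t a b c.
  by rewrite /t (reindex_inj r_inj); apply: eq_bigr => v _; rewrite !sr.
split.
  by rewrite /arc_invariant1 (reindex_inj r_inj); apply: eq_bigr => z _; rewrite !sr tr.
rewrite /arc_invariant2 (reindex_inj r_inj); apply: eq_bigr => z _.
by rewrite (reindex_inj r_inj); apply: eq_bigr => z' _; rewrite !sr !tr.
Qed.

(** Translating both copies by x and fixing oo preserves all signs. *)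
Lemma arc_invariants_out x :
  arc_invariant1 None (Some (x, false)) = arc_invariant1 None (Some (0, false)) /\
  arc_invariant2 None (Some (x, false)) = arc_invariant2 None (Some (0, false)).
Proof.
pose r := omap (fun v : F * bool => (v.1 + x, v.2)).
have r_inj : injective r.
  by move=> [[a b]|] [[c d]|] //= [/addIr -> ->].
have sr a b : s (r a) (r b) = s a b.
  case: a b => [[a []]|] [[b []]|] //=.
  - by congr f; ring.
  - by rewrite (_ : a + x - (b + x) = a - b) //; ring.
  - by rewrite (_ : b + x - (a + x) = b - a) //; ring.
  - by congr f; ring.
by have := arc_invariants_iso None (Some (0, false)) r_inj sr; rewrite /= add0r.
Qed.

(** A symmetry taking 0 of the second copy to oo takes oo to an out-neighbour of oo, hence into the
    first copy; so an arc entering oo and an arc leaving oo have the same invariants. *)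
Lemma szekeres_intransitive : #|F| != 5 ->
  ~ forall x y, exists r, [/\ injective r,
      forall a b, szekeres_arc (r a) (r b) = szekeres_arc a b & r x = y].
Proof.
move=> cF tr; have [r [r_inj er rx]] := tr (Some (0, true)) None.
have sr a b : s (r a) (r b) = s a b by rewrite !szekeres_signE !er.
have [x ry] : exists x, r None = Some (x, false).
  have : szekeres_arc (r (Some (0, true))) (r None) by rewrite er.
  by rewrite rx /szekeres_arc; case: (r None) => [[x []]|] //= _; exists x.
have [] := arc_invariants_iso (Some (0, true)) None r_inj sr.
have [] := arc_invariants_out x.
rewrite rx ry => -> ->.
rewrite arc_invariant1_out arc_invariant1_in arc_invariant2_out arc_invariant2_in.
have p1 : p - 1 != 0.
  by rewrite /p subr_eq0 (eqr_nat int _ 1) gtn_eqF // card_finNzRing_gt1.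
move/(mulIf p1) => e1 e2.
have {}e1 : w ^+ 2 = (u - 1) ^+ 2 by apply: (@mulfI _ 8).
(* The second invariants differ by 32 (p - 1) w^2 (u + 1). If w = 0 then u = 1 and p = 1; if u = -1
   then w^2 = 4 and p = 5. *)
have : (32 * (p - 1)) * (w ^+ 2 * (u + 1)) = 0.
  transitivity (16 * w * (u + 1) * (p - 1) * (w - u + 1) -
      (- 16 * w * (u + 1) * (p - 1) * (w + u - 1))); first by ring.
  by rewrite e2 subrr.
move/eqP; rewrite !mulf_eq0 (negbTE p1) /= orbb => /orP[/eqP w0|].
  move/eqP: p1; apply; move: e1; rewrite szekeres_card w0 expr0n /= addr0.
  by move/esym/eqP; rewrite sqrf_eq0 subr_eq0 => /eqP ->.
rewrite addr_eq0 => /eqP u1; move/eqP: cF; apply.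
by apply/eqP; rewrite -(eqr_nat int); apply/eqP; rewrite -/p szekeres_card e1 u1.
Qed.

End SzekeresSigns.

(** * Adjacency matrices as counts *)

Lemma card_sum (T : finType) (P : pred T) : #|[set z | P z]| = \sum_z (P z : nat).
Proof. by rewrite -sum1dep_card big_mkcond; apply: eq_bigr => z _; case: (P z). Qed.

Section AdjacencyMatrices.
Local Open Scope ring_scope.

(** The matrix of [adjmx] over an arbitrary ring; the rank bound uses rational matrices, for which
    the trace of X X^T is a squared norm. *)
Definition relmx (R : nzRingType) (V : finType) (D : {set V * V}) : 'M[R]_#|V| :=
  \matrix_(i, j) ((enum_val i, enum_val j) \in D)%:R.

Lemma mulmx_relmx (R : nzRingType) (V : finType) (D1 D2 : {set V * V}) i j :
  (relmx R D1 *m relmx R D2) i j =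
  #|[set z | ((enum_val i, z) \in D1) && ((z, enum_val j) \in D2)]|%:R.
Proof.
rewrite mxE card_sum natr_sum (reindex _ (onW_bij _ (@enum_val_bij V))) /=.
by apply: eq_bigr => k _; rewrite !mxE -natrM mulnb.
Qed.

Lemma mulmx_adjmx (V : finType) (D1 D2 : {set V * V}) i j :
  (adjmx D1 *m adjmx D2) i j =
  #|[set z | ((enum_val i, z) \in D1) && ((z, enum_val j) \in D2)]|%:R.
Proof. exact: mulmx_relmx. Qed.

Lemma adjmxT (V : finType) : adjmx [set: V * V] = allone #|V|.
Proof. by apply/matrixP => i j; rewrite !mxE inE. Qed.

Lemma dsrgP (G : digraph) (v k t l m : nat) :
  dsrg G v k t l m <->
  [/\ #|G| = v,
      forall x : G, #|[set y | (x, y) \in arcs G]| = k,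
      forall y : G, #|[set x | (x, y) \in arcs G]| = k &
      forall x y : G, #|[set z | ((x, z) \in arcs G) && ((z, y) \in arcs G)]| =
        if x == y then t else if (x, y) \in arcs G then l else m].
Proof.
have natC (a b : nat) : (a%:R = b%:R :> C) -> a = b by move/eqP; rewrite eqr_nat => /eqP.
have bT : (true%:R : C) = 1 by [].
have bF : (false%:R : C) = 0 by [].
pose simp := (mulr1, mulr0, subr0, subrr, addr0, add0r).
rewrite /dsrg -adjmxT; split=> [[cG AJ JA AA]|[cG od id cc]]; split=> //.
- move=> x; have /matrixP/(_ (enum_rank x) (enum_rank x)) := AJ.
  rewrite mulmx_adjmx !mxE inE mulr1 !enum_rankK => /natC <-.
  by apply: eq_card => z; rewrite !inE andbT.
- move=> x; have /matrixP/(_ (enum_rank x) (enum_rank x)) := JA.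
  rewrite mulmx_adjmx !mxE inE mulr1 !enum_rankK => /natC <-.
  by apply: eq_card => z; rewrite !inE.
- move=> x y; have /matrixP/(_ (enum_rank x) (enum_rank y)) := AA.
  rewrite mulmx_adjmx !mxE inE !enum_rankK (can_eq enum_rankK).
  have [->|xy] := eqVneq x y.
    by rewrite (negbTE (arcs_loopless y)) => e; apply: natC; rewrite e ?bT ?bF ?simp.
  by move=> e; apply: natC; rewrite e; case: ((x, y) \in arcs G); rewrite ?bT ?bF ?simp.
- apply/matrixP => i j; rewrite mulmx_adjmx !mxE inE mulr1 -(od (enum_val i)).
  by congr (_%:R); apply: eq_card => z; rewrite !inE andbT.
- apply/matrixP => i j; rewrite mulmx_adjmx !mxE inE mulr1 -(id (enum_val j)).
  by congr (_%:R); apply: eq_card => z; rewrite !inE.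
- apply/matrixP => i j; rewrite mulmx_adjmx !mxE inE cc (can_eq enum_valK).
  have [->|ij] := eqVneq i j; first by rewrite (negbTE (arcs_loopless _)) ?bT ?bF ?simp.
  by case: ((_, _) \in arcs G); rewrite ?bT ?bF ?simp.
Qed.

End AdjacencyMatrices.

(** * Doubly regular tournaments and the intersection numbers of their doubles *)

Record doubly_regular (V : finType) (e : rel V) (n : nat) : Prop := DoublyRegular {
  dr_irr : irreflexive e;
  dr_tour : forall x y, x != y -> e y x = ~~ e x y;
  dr_card : #|V| = 4 * n + 3;
  dr_out : forall x, #|[set y | e x y]| = 2 * n + 1;
  dr_common : forall x y, x != y -> #|[set z | e x z && e y z]| = n
}.

Section DoubledTournament.

Variables (V : finType) (e : rel V) (n : nat).
Hypothesis dr : doubly_regular e n.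

Let tour := dr_tour dr.
Let irr := dr_irr dr.

(** The four patterns (s, t) partition the 4n + 1 other vertices. Pattern (true, false) is the
    common out-neighbourhood; the out-degrees of x and y then give (true, true) and (false, false),
    and the total gives the last. *)
Lemma dr_paths (s t : bool) x y : x != y ->
  #|[set z | [&& z != x, z != y, e x z == s & e z y == t]]| =
  n + ((s == t) && (s != e x y)).
Proof.
move=> xy; have ne : e y x = ~~ e x y by exact: tour.
have tf : \sum_z [&& z != x, z != y, e x z & ~~ e z y] = n.
  rewrite -card_sum -[RHS](dr_common dr xy); apply: eq_card => z; rewrite !inE.
  have [->|zx] := eqVneq z x; first by rewrite irr.
  have [->|zy] := eqVneq z y; first by rewrite irr andbF.
  by rewrite (tour zy).
have tt : \sum_z [&& z != x, z != y, e x z & e z y] + n + e x y = 2 * n + 1.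
  rewrite -(dr_out dr x) card_sum -{1}tf -big_split /=.
  rewrite [in RHS](bigD1 y) //= addnC [in LHS](bigD1 y) //= eqxx andbF /= add0n; congr (_ + _).
  apply: eq_bigr => z zy; rewrite zy; have [->|zx] := eqVneq z x; first by rewrite irr.
  by case: (e x z) => //=; case: (e z y).
have ff : \sum_z [&& z != x, z != y, ~~ e x z & ~~ e z y] + n + e y x = 2 * n + 1.
  rewrite -(dr_out dr y) card_sum -{1}tf -big_split /=.
  rewrite [in RHS](bigD1 x) //= addnC [in LHS](bigD1 x) //= eqxx /= add0n; congr (_ + _).
  apply: eq_bigr => z zx; rewrite zx; have [->|zy] := eqVneq z y; first by rewrite irr.
  by rewrite (tour zy); case: (e x z); case: (e z y).
have all4 : \sum_z [&& z != x, z != y, e x z & ~~ e z y] +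
  \sum_z [&& z != x, z != y, e x z & e z y] +
  \sum_z [&& z != x, z != y, ~~ e x z & ~~ e z y] +
  \sum_z [&& z != x, z != y, ~~ e x z & e z y] + 2 = 4 * n + 3.
  rewrite -(dr_card dr) -sum1_card -!big_split /=.
  rewrite (bigD1 x) //= eqxx /= add0n (bigD1 y) 1?eq_sym //= eqxx !andbF /= add0n.
  rewrite [in RHS](bigD1 x) //= [in RHS](bigD1 y) 1?eq_sym //= addnC -addnA; congr (_ + (_ + _)).
  apply: eq_bigr => z /andP[-> ->] /=; by case: (e x z); case: (e z y).
rewrite ne in ff; rewrite tf in all4.
rewrite card_sum; case: s t => -[].
- under eq_bigr do rewrite !eqb_id; case: (e x y) tt => /=; lia.
- under eq_bigr do rewrite eqb_id eqbF_neg; rewrite tf /=; lia.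
- under eq_bigr do rewrite eqb_id eqbF_neg; case: (e x y) tt ff => /=; lia.
- under eq_bigr do rewrite !eqbF_neg; case: (e x y) ff => /=; lia.
Qed.

Lemma dr_in y : #|[set x | e x y]| = 2 * n + 1.
Proof.
have : \sum_x e x y + \sum_x e y x + 1 = 4 * n + 3.
  rewrite -(dr_card dr) -sum1_card -!big_split /= (bigD1 y) //= irr add0n.
  rewrite [in RHS](bigD1 y) //= addnC; congr (_ + _).
  by apply: eq_bigr => x xy; rewrite (tour xy); case: (e x y).
by rewrite -!card_sum (dr_out dr); lia.
Qed.

Let W := (V * bool)%type.

Definition kind (a : bool) (x y : V) : option bool :=
  if x == y then None else Some (e x y (+) a).

(* The second half of W carries the reversed tournament: this is the (+) a in
   kind.  The second component tells whether the two points lie in different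
   halves. *)
Definition label (u : W * W) : option bool * bool :=
  (kind u.1.2 u.1.1 u.2.1, u.1.2 (+) u.2.2).

(* The half-bit of the first point has dropped out: this is what makes the
   labels a coherent configuration. *)
Definition inter (k1 k2 k : option bool) (c : bool) : nat :=
  match k1, k2, k with
  | None, _, None => k2 == None
  | None, _, Some t => k2 == Some (t (+) c)
  | Some s, None, _ => k == Some s
  | Some s, Some t, None => if s == t (+) c then 0 else 2 * n + 1
  | Some s, Some t, Some r => n + ((s == t (+) c) && (s != r))
  end.

(** Adding a to both prescribed orientations and to that of (x, y) does not change the correction
    term of [dr_paths], so only c survives. *)
Lemma card_kind a c x y k1 k2 :
  #|[set z | (kind a x z == k1) && (kind (a (+) c) z y == k2)]| =
  inter k1 k2 (kind a x y) c.
Proof.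
case: k1 => [s|]; last first.
  rewrite (_ : [set z | _] = if kind (a (+) c) x y == k2 then [set x] else set0).
    rewrite /kind /inter; case: (x =P y) => _.
      by rewrite eq_sym; case: eqP; rewrite ?cards1 ?cards0.
    by rewrite addbA eq_sym; case: eqP; rewrite ?cards1 ?cards0.
  apply/setP => z; rewrite inE {1}/kind.
  have [<-|xz] := eqVneq x z; first by case: ifP; rewrite !inE ?eqxx.
  by rewrite /=; case: ifP; rewrite inE // [z == x]eq_sym (negbTE xz).
case: k2 => [t|]; last first.
  rewrite (_ : [set z | _] = if kind a x y == Some s then [set y] else set0).
    by rewrite /inter; case: eqP; rewrite ?cards1 ?cards0.
  apply/setP => z; rewrite inE {2}/kind.
  have [<-|zy] := eqVneq z y; first by rewrite andbT; case: ifP; rewrite !inE ?eqxx.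
  by rewrite andbF; case: ifP; rewrite !inE ?(negbTE zy).
have {1}-> : kind a x y = if x == y then None else Some (e x y (+) a) by [].
have [<-|xy] := eqVneq x y => /=.
  have -> : [set z | (kind a x z == Some s) && (kind (a (+) c) z x == Some t)] =
      if s == t (+) c then set0 else
      if s (+) a then [set z | e x z] else [set z | e z x].
    apply/setP => z; rewrite !inE /kind; have [<-|xz] := eqVneq x z.
      by case: ifP => _; [|case: ifP => _]; rewrite inE ?irr.
    rewrite (tour xz).
    case: ifP; [|case: ifP]; rewrite inE ?(tour xz);
    by case: (e x z); move: s t; case: a; case: (c) => -[] [].
  case: ifP => _; first by rewrite cards0.
  by case: ifP => _; rewrite ?(dr_out dr) ?dr_in.
rewrite (_ : [set z | _] =
  [set z | [&& z != x, z != y, e x z == s (+) a & e z y == t (+) (a (+) c)]]).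
  rewrite dr_paths //; congr (_ + _).
  by case: s; case: t; case: a; case: c; case: (e x y).
apply/setP => z; rewrite !inE /kind.
have [<-|_] := eqVneq x z; first by [].
have [<-|_] := eqVneq z y; first by rewrite andbF.
by move: s t; case: (e x z); case: (e z y); case: a; case: c => -[] [].
Qed.

End DoubledTournament.

(** * Coherent configurations through functions constant on basis relations *)

Section Coherent.
Local Open Scope ring_scope.
Variables (V : finType) (T : {set {set V * V}}).
Hypothesis cohT : coherent T.

(** Plays the role of membership in the adjacency algebra, with values allowed in any type. *)
Definition class_function (X : Type) (f : V * V -> X) : Prop :=
  forall R, R \in T -> forall a b, a \in R -> b \in R -> f a = f b.

Let partT : partition T [set: V * V]. Proof. by case: cohT. Qed.

Lemma class_cover a : exists2 R, R \in T & a \in R.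
Proof.
have : a \in cover T by rewrite (cover_partition partT) inE.
by rewrite -mem_pblock => aR; exists (pblock T a) => //; rewrite pblock_mem // -mem_pblock.
Qed.

Lemma class_disjoint R R' a : R \in T -> R' \in T -> a \in R -> a \in R' -> R = R'.
Proof.
have /and3P[_ tT _] := partT => RT RT' aR aR'.
by rewrite -(def_pblock tT RT aR) (def_pblock tT RT' aR').
Qed.

Lemma class_transpose X (f : V * V -> X) :
  class_function f -> class_function (fun a => f (a.2, a.1)).
Proof.
move=> cf R RT a b aR bR; have [_ _ tr _] := cohT.
by apply: (cf _ (tr R RT)); rewrite inE -surjective_pairing.
Qed.

Lemma class_diag : class_function (fun a => a.1 == a.2).
Proof.
move=> R RT a b aR bR; have [_ [P PT cP] _ _] := cohT.
have dP c : (c.1 == c.2) = (c \in cover P) by rewrite cP inE.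
have aux c d : c \in R -> d \in R -> c \in cover P -> d \in cover P.
  move=> cR dR /bigcupP[R' R'P cR']; apply/bigcupP; exists R' => //.
  by rewrite -(class_disjoint RT (subsetP PT _ R'P) cR cR').
by rewrite !dP; apply/idP/idP; apply: aux.
Qed.

Lemma class_union D : union_of_basis T D -> class_function (fun a => a \in D).
Proof.
move=> [P PT <-] R RT a b aR bR.
have aux c d : c \in R -> d \in R -> c \in cover P -> d \in cover P.
  move=> cR dR /bigcupP[R' R'P cR']; apply/bigcupP; exists R' => //.
  by rewrite -(class_disjoint RT (subsetP PT _ R'P) cR cR').
by apply/idP/idP; apply: aux.
Qed.

Lemma union_of_class_function (D : {set V * V}) :
  class_function (fun a => a \in D) -> union_of_basis T D.
Proof.
move=> cD; exists [set R in T | R \subset D].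
  by apply/subsetP => R; rewrite inE => /andP[].
apply/setP => a; apply/bigcupP/idP => [[R]|aD].
  by rewrite inE => /andP[_ /subsetP sub] /sub.
have [R RT aR] := class_cover a; exists R => //; rewrite inE RT.
by apply/subsetP => b bR; rewrite (cD R RT b a).
Qed.

(** Expanding f and g in the indicators of basis relations turns the sum into a combination of
    intersection numbers. *)
Lemma class_mul (f g : V * V -> rat) : class_function f -> class_function g ->
  class_function (fun a => \sum_z f (a.1, z) * g (z, a.2)).
Proof.
(* The value of k on R; the default 0 is met only when R is empty. *)
pose v (k : V * V -> rat) (R : {set V * V}) := if [pick a in R] is Some a then k a else 0.
have vE k : class_function k -> forall a, k a = \sum_(R in T) (a \in R)%:R * v k R.
  move=> ck a; have [R RT aR] := class_cover a.
  rewrite (bigD1 R) //= aR mul1r big1 => [|R' /andP[RT' RR']]; last first.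
    case aR': (a \in R'); last by rewrite mul0r.
    by rewrite (class_disjoint RT RT' aR aR') eqxx in RR'.
  rewrite addr0 /v; case: pickP => [b bR|/(_ a)]; last by rewrite aR.
  exact: (ck R).
move=> cf cg.
have e a : \sum_z f (a.1, z) * g (z, a.2) =
    \sum_(R1 in T) \sum_(R2 in T) v f R1 * v g R2 *
      #|[set z | ((a.1, z) \in R1) && ((z, a.2) \in R2)]|%:R.
  under eq_bigr do rewrite (vE f cf) (vE g cg) mulr_suml.
  rewrite exchange_big /=; apply: eq_bigr => R1 _.
  under eq_bigr do rewrite mulr_sumr.
  rewrite exchange_big /=; apply: eq_bigr => R2 _.
  rewrite card_sum natr_sum mulr_sumr; apply: eq_bigr => z _.
  by rewrite -mulnb natrM; ring.
move=> R RT a b aR bR; rewrite !e; apply: eq_bigr => R1 R1T; apply: eq_bigr => R2 R2T.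
have [_ _ _ /(_ R1 R2 R R1T R2T RT)[q qE]] := cohT.
by case: a aR => a1 a2 aR; case: b bR => b1 b2 bR; rewrite !qE.
Qed.

Lemma class_count (P Q : pred (V * V)) : class_function P -> class_function Q ->
  class_function (fun a => #|[set z | P (a.1, z) && Q (z, a.2)]|).
Proof.
move=> cP cQ R RT a b aR bR.
have cn (k : pred (V * V)) : class_function k -> class_function (fun c => (k c)%:R : rat).
  by move=> ck R' RT' c d cR dR; rewrite (ck R' RT' c d).
have := class_mul (cn P cP) (cn Q cQ) RT aR bR.
have e c : \sum_z (P (c.1, z))%:R * (Q (z, c.2))%:R =
    #|[set z | P (c.1, z) && Q (z, c.2)]|%:R :> rat.
  by rewrite card_sum natr_sum; apply: eq_bigr => z _; rewrite -natrM mulnb.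
by rewrite !e => /eqP; rewrite eqr_nat => /eqP.
Qed.

Lemma class_adjacency_algebra M : M \in adjacency_algebra T ->
  class_function (fun a => M (enum_rank a.1) (enum_rank a.2)).
Proof.
move=> MT R RT a b aR bR.
rewrite (coord_span (X := in_tuple _) MT) !summxE; apply: eq_bigr => i _.
rewrite [LHS]mxE [RHS]mxE; congr (_ * _).
have /mapP[R' R'T ->] : (in_tuple [seq adjmx R' | R' <- enum T])`_i \in
    [seq adjmx R' | R' <- enum T] by apply: mem_nth; rewrite ltn_ord.
rewrite mem_enum in R'T; rewrite !mxE !enum_rankK -!surjective_pairing; congr (_%:R).
have [aR'|aR'] := boolP (a \in R').
  by rewrite -(class_disjoint RT R'T aR aR') bR.
have [bR'|//] := boolP (b \in R').
by rewrite -(class_disjoint RT R'T bR bR') aR in aR'.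
Qed.

Lemma class_adjmx (D : {set V * V}) : adjmx D \in adjacency_algebra T ->
  class_function (fun a => a \in D).
Proof.
move=> DT R RT a b aR bR; have := class_adjacency_algebra DT RT aR bR.
rewrite !mxE !enum_rankK -!surjective_pairing => /eqP; rewrite eqr_nat.
by case: (a \in _); case: (b \in _).
Qed.

End Coherent.

(** * The rank-six scheme, its digraph and its automorphisms *)

Section DoubledScheme.

Variables (V : finType) (e : rel V) (n : nat).
Hypothesis dr : doubly_regular e n.

Let tour := dr_tour dr.
Let irr := dr_irr dr.
Local Notation W := (V * bool)%type.
Local Notation label := (label e).

(** The half of z is forced by the first label, and the second label is then compatible only if the
    half-bits add up; what remains is a count in the tournament. *)
Lemma card_label (a : W * W) l1 l2 :
  #|[set z | (label (a.1, z) == l1) && (label (z, a.2) == l2)]| =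
  if l1.2 (+) l2.2 == (label a).2 then inter n l1.1 l2.1 (label a).1 l1.2 else 0.
Proof.
case: a l1 l2 => -[x c] [y d] [k1 c1] [k2 c2] /=; rewrite -(card_kind dr).
have [ecd|ncd] := eqVneq (c1 (+) c2) (c (+) d); last first.
  apply/eqP; rewrite cards_eq0; apply/eqP/setP => -[z b]; rewrite !inE /label /= !xpair_eqE.
  apply/negP => /andP[/andP[_ /eqP e1] /andP[_ /eqP e2]].
  by move/eqP: ncd; apply; rewrite -e1 -e2; case: (c) (b) (d) => -[] [].
rewrite -(card_imset (f := fun z : V => (z, c (+) c1))); last by move=> z z' [].
apply: eq_card => -[z b]; rewrite !inE /label /= !xpair_eqE.
apply/idP/imsetP => [/andP[/andP[ek1 /eqP e1] /andP[ek2 /eqP e2]]|[z' zP [-> ->]]].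
  have eb : b = c (+) c1 by rewrite -e1 addKb.
  by exists z; rewrite ?inE -eb // ek1 ek2.
move: zP; rewrite inE => /andP[-> ->] /=; rewrite addKb eqxx /=.
by apply/eqP; move: ecd; case: (c) (c1) (c2) (d) => -[] [] [].
Qed.

(** This makes the six classes nonempty, hence pairwise distinct. *)
Lemma label_surj l : exists a, label a = l.
Proof.
have [x _] : exists x : V, true.
  have : 0 < #|V| by rewrite (dr_card dr); lia.
  by case/card_gt0P => x _; exists x.
have [y xy] : exists y, e x y.
  have : 0 < #|[set y | e x y]| by rewrite (dr_out dr); lia.
  by case/card_gt0P => y; rewrite inE; exists y.
have [z zx] : exists z, e z x.
  have : 0 < #|[set y | e y x]| by rewrite (dr_in dr); lia.
  by case/card_gt0P => z; rewrite inE; exists z.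
have ny : x != y by apply: contraTneq xy => ->; rewrite irr.
have nz : x != z by apply: contraTneq zx => ->; rewrite irr.
case: l => [[[]|] c].
- by exists ((x, false), (y, c)); rewrite /label /kind /= (negbTE ny) xy.
- by exists ((x, false), (z, c)); rewrite /label /kind /= (negbTE nz) -[e x z]negbK -(tour nz) zx.
- by exists ((x, false), (x, c)); rewrite /label /kind /= eqxx.
Qed.

Lemma label_diag a : (label a == (None, false)) = (a.1 == a.2).
Proof.
case: a => -[x c] [y d]; rewrite /label /kind /=.
have [->|xy] := eqVneq x y; first by case: c; case: d; rewrite !xpair_eqE !eqxx.
by rewrite !xpair_eqE (negbTE xy).
Qed.

(** Reversal flips the orientation, and reading it from the other half flips it again; so the
    classes with second component true are symmetric. *)
Definition label_transpose (l : option bool * bool) : option bool * bool :=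
  (omap (fun s => ~~ s (+) l.2) l.1, l.2).

Lemma label_swap a : label (a.2, a.1) = label_transpose (label a).
Proof.
case: a => -[x c] [y d]; rewrite /label /label_transpose /kind /=.
have [_|xy] := eqVneq x y; first by rewrite addbC.
by rewrite (tour xy) /= [d (+) c]addbC; congr (Some _, _); case: (e x y) (c) (d) => -[] [].
Qed.

Lemma label_transposeK : involutive label_transpose.
Proof. by case=> -[[]|] []. Qed.

Definition doubled_arcs : {set W * W} := [set a | (label a).1 == Some true].

Lemma doubled_loopless x : (x, x) \notin doubled_arcs.
Proof. by rewrite inE /label /kind /= eqxx. Qed.

Definition doubled : digraph := Digraph doubled_loopless.

Definition doubled_class l : {set W * W} := [set a | label a == l].

Definition doubled_scheme : {set {set W * W}} := [set doubled_class l | l : option bool * bool].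

Lemma doubled_class_inj : injective doubled_class.
Proof.
move=> l l' /setP e'; have [a la] := label_surj l.
by have := e' a; rewrite !inE la eqxx => /esym/eqP.
Qed.

Lemma doubled_partition : partition doubled_scheme [set: W * W].
Proof.
apply/and3P; split.
- apply/eqP/setP => a; rewrite inE; apply/bigcupP; exists (doubled_class (label a)).
    exact: imset_f.
  by rewrite inE.
- apply/trivIsetP => _ _ /imsetP[l _ ->] /imsetP[l' _ ->] ll'.
  rewrite -setI_eq0; apply/eqP/setP => a; rewrite !inE.
  by apply/negP => /andP[/eqP el /eqP el']; rewrite -el -el' eqxx in ll'.
- apply/imsetP => -[l _ /setP e0]; have [a la] := label_surj l.
  by have := e0 a; rewrite !inE la eqxx.
Qed.

Lemma doubled_homogeneous : homogeneous doubled_scheme.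
Proof.
apply/imsetP; exists (None, false) => //.
by apply/setP => a; rewrite !inE label_diag.
Qed.

Lemma doubled_coherent : coherent doubled_scheme.
Proof.
split.
- exact: doubled_partition.
- exists [set diag_rel _]; first by rewrite sub1set doubled_homogeneous.
  by rewrite /cover big_set1.
- move=> _ /imsetP[l _ ->]; apply/imsetP; exists (label_transpose l) => //.
  apply/setP => a; rewrite !inE label_swap.
  by rewrite -(inj_eq (inv_inj label_transposeK)) label_transposeK.
move=> _ _ _ /imsetP[l1 _ ->] /imsetP[l2 _ ->] /imsetP[l3 _ ->].
exists (if l1.2 (+) l2.2 == l3.2 then inter n l1.1 l2.1 l3.1 l1.2 else 0) => x y.
rewrite inE => /eqP <-; rewrite -card_label.
by apply: eq_card => z; rewrite !inE.
Qed.

Lemma doubled_rank : rank doubled_scheme = 6.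
Proof.
rewrite /rank card_imset; last exact: doubled_class_inj.
by rewrite card_prod card_option !card_bool.
Qed.

Lemma doubled_dsrg :
  dsrg doubled (4 * (2 * n + 1) + 2) (2 * (2 * n + 1)) (2 * n + 1) (2 * n) (2 * n + 1).
Proof.
have out a x : #|[set y | kind e a x y == Some true]| = 2 * n + 1.
  case: a; last first.
    rewrite -(dr_out dr x); apply: eq_card => y; rewrite !inE /kind.
    by have [->|_] := eqVneq x y; rewrite ?irr // addbF; case: (e x y).
  rewrite -(dr_in dr x); apply: eq_card => y; rewrite !inE /kind.
  by have [->|xy] := eqVneq x y; rewrite ?irr // (tour xy) addbT; case: (e x y).
have doubleC (P : pred V) : #|[set z : W | P z.1]| = 2 * #|[set z | P z]|.
  rewrite (_ : [set z : W | _] = setX [set z | P z] [set: bool]).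
    by rewrite cardsX cardsT card_bool mulnC.
  by apply/setP => -[z c]; rewrite !inE andbT.
apply/dsrgP; split.
- by rewrite card_prod card_bool (dr_card dr); lia.
- move=> [x a]; rewrite -(out a x) -doubleC.
  by apply: eq_card => -[y b]; rewrite !inE.
- move=> [y b].
  (* The orientation is that of the half of the tail: in-neighbours come from out-neighbours of y in
     the reversed half and from in-neighbours of y in the other. *)
  have -> : [set x : W | (x, (y, b)) \in doubled_arcs] =
      [set (z, true) | z in [set z | e y z]] :|: [set (z, false) | z in [set z | e z y]].
    apply/setP => -[x a]; rewrite !inE /label /kind /=.
    have [->|xy] := eqVneq x y.
      apply/esym/negP => /orP[] /imsetP[z]; rewrite inE => yz [zy _];
      by rewrite zy irr in yz.
    apply/idP/orP => [|[] /imsetP[z]]; rewrite ?inE.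
    + case: a => ex; [left | right]; apply/imsetP; exists x; rewrite ?inE //.
        by rewrite (tour xy); move: ex; rewrite addbT => /eqP[->].
      by move: ex; rewrite addbF => /eqP[->].
    + by move=> yz [xz ->]; rewrite addbT -(tour xy) xz yz.
    + by move=> yz [xz ->]; rewrite addbF xz yz.
  rewrite cardsU (_ : _ :&: _ = set0) ?cards0.
    rewrite !card_imset; try by move=> z z' [].
    by rewrite (dr_out dr) (dr_in dr); lia.
  by apply/setP => -[x a]; rewrite !inE; apply/negP => /andP[/imsetP[z _ [_ ->]] /imsetP[z' _ []]].
move=> x y.
(* Splitting the paths by the half-bits of their two arcs makes [card_label] applicable. *)
have -> : #|[set z : W | ((x, z) \in doubled_arcs) && ((z, y) \in doubled_arcs)]| =
   \sum_(c1 : bool) \sum_(c2 : bool)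
     #|[set z : W | (label (x, z) == (Some true, c1)) && (label (z, y) == (Some true, c2))]|.
  rewrite card_sum; under [RHS]eq_bigr do under eq_bigr do rewrite card_sum.
  under [RHS]eq_bigr do rewrite exchange_big /=.
  rewrite [RHS]exchange_big /=; apply: eq_bigr => z _.
  rewrite !big_bool !inE; case: (label (x, z)) => k1 []; case: (label (z, y)) => k2 [];
  by rewrite !xpair_eqE /= !andbF !andbT !addn0 ?add0n.
under eq_bigr do under eq_bigr do rewrite (card_label (x, y)).
rewrite !big_bool !inE; move: (label_diag (x, y)); move: (label (x, y)) => l /= <-.
by case: l => -[[]|] [] /=; lia.
Qed.


Lemma doubled_noncommutative : noncommutative doubled_scheme.
Proof.
move=> comm.
have inA l : adjmx (doubled_class l) \in adjacency_algebra doubled_scheme.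
  by apply/memv_span/map_f; rewrite mem_enum; apply: imset_f.
(* At a pair of the class R F the product R F has entry 1, while F R = R^T F has entry 0. *)
have [[x y] la] := label_surj (Some true, true).
have := comm _ _ (inA (Some true, false)) (inA (None, true)).
move/matrixP/(_ (enum_rank x) (enum_rank y))/eqP; rewrite !mulmx_adjmx !enum_rankK eqr_nat.
have cc l1 l2 : #|[set z | ((x, z) \in doubled_class l1) && ((z, y) \in doubled_class l2)]| =
   if l1.2 (+) l2.2 == (label (x, y)).2 then inter n l1.1 l2.1 (label (x, y)).1 l1.2 else 0.
  by rewrite -(card_label (x, y)); apply: eq_card => z; rewrite !inE.
by rewrite !cc la.
Qed.

(** These are the entries of A A^T: (y, z) is an arc exactly when (z, y) carries a label (Some c2,
    c2). *)
Lemma card_common_out x y : #|[set z | ((x, z) \in doubled_arcs) && ((y, z) \in doubled_arcs)]| =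
  \sum_(c1 : bool) \sum_(c2 : bool)
    if c1 (+) c2 == (label (x, y)).2 then inter n (Some true) (Some c2) (label (x, y)).1 c1 else 0.
Proof.
under [RHS]eq_bigr do under eq_bigr do
  rewrite -(card_label (x, y) (Some true, _) (Some _, _)) card_sum.
under [RHS]eq_bigr do rewrite exchange_big /=.
rewrite card_sum [RHS]exchange_big /=; apply: eq_bigr => z _.
rewrite !big_bool !inE (label_swap (z, y)); case: (label (x, z)) => k1 c1.
by case: (label (z, y)) => -[[]|] []; rewrite !xpair_eqE /=; case: (k1 == Some true); case: c1.
Qed.

Lemma doubled_WL : is_WL_closure doubled doubled_scheme.
Proof.
split; first exact: doubled_coherent.
  have -> : adjmx (arcs doubled) =
      (adjmx (doubled_class (Some true, true)) + adjmx (doubled_class (Some true, false)))%R.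
    apply/matrixP => i j; rewrite !mxE !inE -natrD; congr (_%:R)%R.
    by case: (label _) => -[[]|] [].
  by apply: rpredD; apply/memv_span/map_f; rewrite mem_enum; apply: imset_f.
move=> T cT algT R RT.
have cA : class_function T (fun a => a \in doubled_arcs) by exact: class_adjmx.
have cA' := class_transpose cT cA.
have cC := class_count cT cA cA'; have cD := class_diag cT.
have [a aR] : exists a, a \in R.
  apply/set0Pn; have [/and3P[_ _ T0] _ _ _] := cT.
  by apply: contraNneq T0 => <-.
exists (doubled_class (label a)); first exact: imset_f.
apply/subsetP => b bR; rewrite inE.
have := cC R RT a b aR bR; have := cD R RT a b aR bR.
have := cA R RT a b aR bR; have := cA' R RT a b aR bR.
(* A, A^T and the diagonal already separate all classes except F from R^T F; there are no common
   out-neighbours on F and 2n + 2 on R^T F. *)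
rewrite /= !card_common_out -!label_diag -!surjective_pairing !inE !label_swap !big_bool.
by case: (label a) => -[[]|] []; case: (label b) => -[[]|] [] //= _ _ _; lia.
Qed.

(** The arcs without a reverse arc form R = diag(T, T^T), so every automorphism preserves R. *)
Lemma oneway_label (a : W * W) :
  (a \in doubled_arcs) && ((a.2, a.1) \notin doubled_arcs) = (label a == (Some true, false)).
Proof. by rewrite !inE label_swap; case: (label a) => -[[]|] []. Qed.

Lemma label_first_half x y : (label ((x, false), (y, false)) == (Some true, false)) = e x y.
Proof.
rewrite /label /kind /=; have [->|_] := eqVneq x y; first by rewrite irr.
by rewrite addbF; case: (e x y).
Qed.

(** R joins only points of the same half, and any two distinct points of a half are joined by R one
    way or the other. An automorphism sending one point of the first half into the first half thus
    preserves that half and acts on T. *)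
Lemma doubled_transitive : vertex_transitive doubled ->
  forall x y, exists r, [/\ injective r, forall a b, e (r a) (r b) = e a b & r x = y].
Proof.
move=> tr x y.
have [s /digraph_autP s_aut sx] :=
  atransP2 tr (in_setT ((x, false) : doubled)) (in_setT ((y, false) : doubled)).
rewrite /= apermE in sx.
have ow u v : (label (s u, s v) == (Some true, false)) = (label (u, v) == (Some true, false)).
  by rewrite -!oneway_label /= !s_aut.
have half z : (s (z, false)).2 = false.
  have [->|xz] := eqVneq z x; first by rewrite -sx.
  case exz : (e x z).
    move: exz; rewrite -label_first_half -ow -sx => /eqP[_].
    by rewrite /=; case: (s _).2.
  have : e z x by rewrite (tour _) ?exz // eq_sym.
  rewrite -label_first_half -ow -sx => /eqP[_].
  by rewrite /=; case: (s _).2.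
have sE z : s (z, false) = ((s (z, false)).1, false) by rewrite -{3}(half z) -surjective_pairing.
exists (fun z => (s (z, false)).1); split.
- move=> z z' ez; have : s (z, false) = s (z', false) by rewrite sE [RHS]sE ez.
  by move/perm_inj => [].
- by move=> a b; rewrite -label_first_half -!sE ow label_first_half.
- by move/(congr1 fst): sx => /=.
Qed.

End DoubledScheme.

(** * From sign matrices to tournaments, and the digraph for a given prime *)

Section SzekeresDigraph.
Local Open Scope ring_scope.

(** The indicator e of an arc satisfies 2e = s^2 + s, which turns out-degrees and common
    out-neighbour counts into row sums and Gram entries. *)
Lemma doubly_regular_of_signs (V : finType) (s : V -> V -> int) n :
    (forall x y, s x y ^+ 2 = (x != y)%:R) -> (forall x y, s y x = - s x y) ->
    #|V| = (4 * n + 3)%N -> (forall x, \sum_z s x z = 0) ->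
    (forall x y, x != y -> \sum_z s x z * s y z = - 1) ->
  doubly_regular (fun x y => s x y == 1) n.
Proof.
move=> sq anti cV s0 gram; pose e x y := s x y == 1.
have sE (x y : V) : 2 * (e x y)%:R = s x y ^+ 2 + s x y.
  rewrite /e; have /eqP := sq x y.
  case: (x =P y) => _ /=; first by rewrite sqrf_eq0 => /eqP ->.
  by rewrite sqrf_eq1 => /orP[] /eqP ->.
have irr (x : V) : e x x = false.
  have := sE x x; rewrite sq eqxx /=.
  have /eqP : s x x ^+ 2 = 0 by rewrite sq eqxx.
  by rewrite sqrf_eq0 => /eqP ->; case: (e x x).
have sum1 : \sum_(z : V) (1 : int) = (4 * n + 3)%:R.
  by rewrite sumr_const cV.
have sumneq (x : V) : \sum_z (x != z)%:R = (4 * n + 2)%:R :> int.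
  rewrite (bigD1 x) //= eqxx add0r (eq_bigr (fun=> 1)) => [|z zx]; last by rewrite eq_sym zx.
  rewrite sumr_const (_ : #|_| = #|predC1 x|); last exact: eq_card.
  by rewrite cardC1 cV addnS.
split=> //.
- move=> x y xy; have := sE x y; have := sE y x.
  rewrite (anti x y) sqrrN !sq xy; have /eqP := sq x y; rewrite xy sqrf_eq1.
  by case/orP => /eqP ->; case: (e x y); case: (e y x).
- move=> x; apply/eqP; rewrite -(eqr_nat int); apply/eqP.
  apply: (@mulfI _ 2) => //; rewrite card_sum natr_sum mulr_sumr.
  under eq_bigr do rewrite sE sq; rewrite big_split /= sumneq s0.
  ring.
move=> x y xy; apply/eqP; rewrite -(eqr_nat int); apply/eqP.
apply: (@mulfI _ 4) => //; rewrite card_sum natr_sum mulr_sumr.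
(* The summands agree for z different from x and y; at these two points the right side has s y x and
   s x y, which cancel. *)
have -> : \sum_(z : V) 4 * (e x z && e y z)%:R =
   \sum_(z : V) ((x != z)%:R + (y != z)%:R - 1 + s x z + s y z + s x z * s y z).
  rewrite (bigD1 x) //= [in RHS](bigD1 x) //= (bigD1 y) 1?eq_sym //= [in RHS](bigD1 y) 1?eq_sym //=.
  rewrite !irr andbF /= !eqxx [y == x]eq_sym xy /=.
  rewrite (eq_bigr (fun z => (x != z)%:R + (y != z)%:R - 1 + s x z + s y z +
    s x z * s y z)); last first.
    move=> z /andP[zx zy]; have ex := sE x z; have ey := sE y z.
    transitivity ((2 * (e x z)%:R) * (2 * (e y z)%:R) : int).
      by rewrite -mulnb natrM; ring.
    rewrite ex ey !sq eq_sym zx eq_sym zy /=; ring.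
  have sx : s x x = 0 by apply/eqP; rewrite -(sqrf_eq0 (s x x)) sq eqxx.
  have sy : s y y = 0 by apply/eqP; rewrite -(sqrf_eq0 (s y y)) sq eqxx.
  rewrite sx sy (anti x y); ring.
rewrite !big_split /= !sumneq !s0 gram //.
rewrite sumrN sum1; ring.
Qed.

Lemma szekeres_doubly_regular (F : finFieldType) (f h : F -> int) u w n :
  szekeres_pair f h u w -> #|F| = (2 * n + 1)%N ->
  doubly_regular (szekeres_arc f h) n.
Proof.
move=> sz cF; apply: doubly_regular_of_signs.
- exact: szekeres_sign_sq sz.
- exact: szekeres_sign_anti sz.
- by rewrite card_option card_prod card_bool cF; lia.
- exact: szekeres_sign_sum sz.
move=> x y xy; rewrite (szekeres_sign_gram sz) (_ : (x == y) = false); last exact/negbTE.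
by rewrite mulr0 add0r.
Qed.

Theorem szekeres_digraph (p : nat) : prime p -> p = 5 %[mod 8] -> (13 <= p)%N ->
  exists G : digraph,
    [/\ intransitive G, dsrg G (4 * p + 2) (2 * p) p (p - 1) p &
        has_noncommutative_WL_scheme_of_rank G 6].
Proof.
move=> p_pr p5 p13.
pose m := ((p - 1) %/ 4)%N.
have pE : p = (4 * m).+1%N by rewrite /m; lia.
have odd_m : odd m by rewrite /m; lia.
have e1 : (2 * (2 * m) + 1 = p)%N by lia.
have e2 : (2 * (2 * m) = p - 1)%N by lia.
have p_neq5 : p != 5 by lia.
have cF : #|'F_p| = (4 * m)%N.+1 by rewrite card_Fp.
have [f [h [u [w sz]]]] := szekeres_pair_exists odd_m cF.
have dr : doubly_regular (szekeres_arc f h) (2 * m).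
  by apply: (szekeres_doubly_regular sz); rewrite cF -pE e1.
exists (doubled (szekeres_arc f h)); split.
- move=> /(doubled_transitive dr); apply: (szekeres_intransitive sz).
  by rewrite cF -pE.
- by have := doubled_dsrg dr; rewrite e1 e2.
- exists (doubled_scheme (szekeres_arc f h)); split.
  + exact: doubled_WL dr.
  + by split; [exact: doubled_coherent dr | exact: doubled_homogeneous].
  + exact: doubled_noncommutative dr.
  + exact: doubled_rank dr.
Qed.

End SzekeresDigraph.

(** * Infinitely many primes congruent to 5 modulo 8 *)

Lemma prime_dvd_sqrD4 q x : prime q -> odd q -> q %| x ^ 2 + 4 -> q = 1 %[mod 4].
Proof.
move=> q_pr q_odd qx.
have m4 : q %% 4 = 1 \/ q %% 4 = 3 by lia.
case: m4 => // q3; exfalso.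
pose k := q %/ 4; have kE : q = 4 * k + 3 by rewrite /k; lia.
have two0 : (2%:R : 'F_q)%R != 0%R.
  rewrite -(dvdn_pcharf (pchar_Fp q_pr)); apply/negP => /dvdn_leq => /(_ isT).
  by have := prime_gt1 q_pr; lia.
have fermat (y : 'F_q) : (y != 0 -> y ^+ (2 * (2 * k).+1) = 1)%R.
  move=> y0; apply: (mulfI y0); rewrite mulr1 -exprS.
  by rewrite (_ : _.+1 = #|'F_q|); [exact: expf_card | rewrite card_Fp // [RHS]kE; lia].
have xx : ((x%:R : 'F_q) ^+ 2 = - 2%:R ^+ 2)%R.
  apply/eqP; rewrite -addr_eq0 -!natrX -natrD.
  by rewrite -(dvdn_pcharf (pchar_Fp q_pr)).
have x0 : (x%:R : 'F_q)%R != 0%R.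
  by rewrite -sqrf_eq0 xx oppr_eq0 sqrf_eq0.
(* Raising x^2 = - 2^2 to the odd power (q - 1)/2 = 2k + 1 gives 1 = -1 by Fermat. *)
have := fermat _ x0; rewrite exprM xx exprNn -exprM (fermat _ two0) mulr1.
rewrite -signr_odd /= oddM /= expr1 => /eqP; rewrite eq_sym -addr_eq0.
exact/negP.
Qed.

Lemma primes_5mod8_unbounded k : exists p, [/\ prime p, p = 5 %[mod 8] & k < p].
Proof.
(* All prime factors of x^2 + 4 are 1 mod 4 and none is at most k; since
   x^2 + 4 is 5 mod 8, they are not all 1 mod 8. *)
pose x := \prod_(1 <= q < k.+1 | odd q) q.
have x_odd : odd x by rewrite /x; elim/big_ind: _ => // a b oa ob; rewrite oddM oa ob.
have N5 : (x ^ 2 + 4) %% 8 = 5.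
  have [y ->] : exists y, x = 2 * y + 1 by exists (x %/ 2); lia.
  have [z ez] : exists z, y * (y + 1) = 2 * z.
    by exists (y * (y + 1) %/ 2); have := oddM y (y + 1); lia.
  have -> : (2 * y + 1) ^ 2 + 4 = 4 * (y * (y + 1)) + 5 by rewrite expnS expn1; lia.
  by rewrite ez; lia.
have [/hasP[p]|/hasPn no5] := boolP (has (fun q => q %% 8 == 5) (primes (x ^ 2 + 4))).
  rewrite mem_primes => /and3P[p_pr _ px] /eqP p5; exists p; split=> //.
  rewrite ltnNge; apply/negP => pk.
  have p_odd : odd p by lia.
  have px' : p %| x.
    rewrite /x (big_rem p) /= ?p_odd ?dvdn_mulr //.
    by rewrite mem_index_iota prime_gt0.
  have : p %| 4 by move: px; rewrite dvdn_addr // expnS dvdn_mulr.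
  by move/dvdn_leq => /(_ isT); have := prime_gt1 p_pr; lia.
exfalso.
have prod1 : (x ^ 2 + 4) %% 8 = 1.
  rewrite [x ^ 2 + 4]prod_prime_decomp ?addn_gt0 ?orbT //.
  rewrite prime_decompE big_map /=.
  rewrite big_seq; elim/big_ind: _ => // [a b ea eb|q].
    by rewrite -modnMm ea eb.
  move=> q_in; have := no5 q q_in; move: q_in; rewrite mem_primes => /and3P[q_pr _ qx] q5.
  have q_odd : odd q.
    apply: contraLR qx => q_even; have -> : q = 2 by move: q_even; case/even_prime: q_pr => // ->.
    rewrite dvdn2 oddD oddX /= x_odd //.
  have q1 : q %% 8 = 1 by have := prime_dvd_sqrD4 q_pr q_odd qx; lia.
  by rewrite -modnXm q1 exp1n.
by rewrite prod1 in N5.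
Qed.

(** * Normal matrices and commutators over the rationals *)

Section RationalMatrices.
Local Open Scope ring_scope.
Variable N : nat.
Implicit Types (A B X Y Z P Q : 'M[rat]_N).
Local Notation J := (const_mx 1 : 'M[rat]_N).

Lemma mxtrace_norm_ge0 X : 0 <= \tr (X *m X^T).
Proof.
rewrite /mxtrace; apply: sumr_ge0 => i _; rewrite mxE; apply: sumr_ge0 => j _.
by rewrite mxE -expr2 sqr_ge0.
Qed.

Lemma mxtrace_norm_eq0 X : \tr (X *m X^T) = 0 -> X = 0.
Proof.
have ge0 i : true -> 0 <= (X *m X^T) i i.
  by move=> _; rewrite mxE; apply: sumr_ge0 => j _; rewrite mxE -expr2 sqr_ge0.
move=> /eqP; rewrite /mxtrace psumr_eq0 // => /allP e0.
apply/matrixP => i j; rewrite mxE.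
have /eqP := e0 i (mem_index_enum i); rewrite mxE => /eqP.
rewrite psumr_eq0 => [/allP/(_ j (mem_index_enum j))|k _]; last by rewrite mxE -expr2 sqr_ge0.
by rewrite /= mxE -expr2 sqrf_eq0 => /eqP.
Qed.

Lemma mulmx_allone : J *m J = N%:R *: J.
Proof.
apply/matrixP => i j; rewrite !mxE (eq_bigr (fun=> 1)) => [|k _]; last by rewrite !mxE mulr1.
by rewrite sumr_const card_ord mulr1.
Qed.

Lemma trmx_allone : J^T = J.
Proof. by apply/matrixP => i j; rewrite !mxE. Qed.

Lemma mxtrace_allone : \tr J = N%:R.
Proof.
rewrite /mxtrace (eq_bigr (fun=> 1)) => [|i _]; last by rewrite mxE.
by rewrite sumr_const card_ord.
Qed.

(* W = A - A^T satisfies W^3 = D W with D = c^2 + 4 q, and D < 0 because W is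
   skew.  With U = A + A^T, the multiple E of the projection onto ker W and the
   orthogonal of 1 satisfies (U - c)^2 E = D E, so E = 0 and W^2 is a multiple of I - J/N; then
   U W = c W determines U. *)
Lemma normal_quadratic A (k c q m : rat) :
    (0 < N)%N -> A *m J = k *: J -> J *m A = k *: J ->
    A *m A = c *: A + q *: 1%:M + m *: J -> A *m A^T = A^T *m A ->
    A^T != A ->
  exists b, A + A^T = c *: 1%:M + b *: J.
Proof.
move=> N0 AJ JA AA nA asymA; set B := A^T.
have BJ : B *m J = k *: J by rewrite -trmx_allone -trmx_mul JA linearZ.
have JB : J *m B = k *: J by rewrite -trmx_allone -trmx_mul AJ linearZ.
have BB : B *m B = c *: B + q *: 1%:M + m *: J.
  by rewrite -trmx_mul AA !linearD !linearZ /= trmx1 trmx_allone.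
have AB : A *m B = B *m A by [].
set W := A - B; set U := A + B; set D := c ^+ 2 + 4 * q.
have trW : W^T = - W by rewrite linearB /= trmxK opprB.
have trU : U^T = U by rewrite linearD /= trmxK addrC.
have WJ : W *m J = 0 by rewrite mulmxBl AJ BJ subrr.
have JW : J *m W = 0 by rewrite mulmxBr JA JB subrr.
have UW : U *m W = c *: W.
  rewrite /U /W mulmxDl !mulmxBr AA BB AB; apply/matrixP => i j; rewrite !mxE; ring.
have WU : W *m U = c *: W.
  rewrite /U /W mulmxBl !mulmxDr AA BB AB; apply/matrixP => i j; rewrite !mxE; ring.
have WW : W *m W = c *: U + (2 * q) *: 1%:M + (2 * m) *: J - 2 *: (A *m B).
  rewrite {1 2}/W mulmxBl !mulmxBr AA BB AB; apply/matrixP => i j; rewrite !mxE; ring.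
have UU : U *m U = c *: U + (2 * q) *: 1%:M + (2 * m) *: J + 2 *: (A *m B).
  rewrite {1 2}/U mulmxDl !mulmxDr AA BB AB; apply/matrixP => i j; rewrite !mxE; ring.
have WAB : W *m (A *m B) = - q *: W.
  rewrite /W mulmxBl mulmxA AA mulmxA -AB -[A *m B *m B]mulmxA BB.
  rewrite !mulmxDl !mulmxDr -!scalemxAl -!scalemxAr JB AJ mul1mx mulmx1.
  apply/matrixP => i j; rewrite !mxE; ring.
have WWW : W *m (W *m W) = D *: W.
  rewrite WW mulmxBr !mulmxDr -!scalemxAr WU WJ WAB mulmx1 /D.
  apply/matrixP => i j; rewrite !mxE; ring.
have W0 : W != 0 by rewrite subr_eq0 eq_sym.
have UJ : U *m J = (2 * k) *: J by rewrite mulmxDl AJ BJ -scalerDl; congr (_ *: _); ring.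
clearbody W U.
(* W is skew and nonzero, and -tr(W^2) is its squared Frobenius norm. *)
have s_gt0 : \tr (W *m W) < 0.
  rewrite -oppr_gt0 -linearN /= -mulmxN -trW lt_def mxtrace_norm_ge0 andbT.
  by apply: contraNneq W0 => /mxtrace_norm_eq0 ->.
have trWW : (W *m W)^T = W *m W by rewrite trmx_mul trW mulNmx mulmxN opprK.
(* D tr(W^2) = tr(W^4) is the squared norm of the symmetric matrix W^2, which is nonzero because its
   trace is. *)
have D_lt0 : D < 0.
  have e : \tr (W *m W *m (W *m W)^T) = D * \tr (W *m W).
    by rewrite trWW -mulmxA WWW -scalemxAr linearZ.
  have := mxtrace_norm_ge0 (W *m W); rewrite e.
  have ne : D * \tr (W *m W) != 0.
    apply: contraTneq s_gt0; rewrite -e => /mxtrace_norm_eq0 ->.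
    by rewrite linear0 ltxx.
  by move=> h; have := lt_def 0 (D * \tr (W *m W)); rewrite ne h /= nmulr_lgt0.
pose E : 'M[rat]_N := D *: 1%:M - (D / N%:R) *: J - W *m W.
have N0' : N%:R != 0 :> rat by rewrite pnatr_eq0 -lt0n.
have trE : E^T = E.
  by rewrite /E !linearB !linearZ /= trmx1 trmx_allone trWW.
have WWE : W *m W *m E = 0.
  rewrite /E !mulmxBr -!scalemxAr mulmx1 -!mulmxA WJ WWW -scalemxAr !mulmx0.
  by rewrite scaler0 subr0 subrr.
have JE : J *m E = 0.
  rewrite /E !mulmxBr -!scalemxAr mulmx1 mulmx_allone mulmxA JW mul0mx subr0 scalerA.
  by rewrite divfK // subrr.
have UcUcE : (U - c *: 1%:M) *m (U - c *: 1%:M) *m E = D *: E.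
  have -> : (U - c *: 1%:M) *m (U - c *: 1%:M) = D *: 1%:M + (4 * m) *: J - W *m W.
    rewrite mulmxBl !mulmxBr -!scalemxAl -!scalemxAr !mul1mx mulmx1 UU WW /D.
    apply/matrixP => i j; rewrite !mxE; ring.
  by rewrite mulmxBl mulmxDl -!scalemxAl mul1mx JE WWE scaler0 addr0 subr0.
(* The squared norm of (U - c) E is D times that of E, and D is negative. *)
have E0 : E = 0.
  apply: mxtrace_norm_eq0; apply/eqP; rewrite eq_le mxtrace_norm_ge0 andbT.
  rewrite -(nmulr_rge0 _ D_lt0).
  have := mxtrace_norm_ge0 ((U - c *: 1%:M) *m E)^T.
  rewrite trmxK trmx_mul trE linearB linearZ /= trU trmx1.
  by rewrite -mulmxA [X in E *m X]mulmxA UcUcE -scalemxAr linearZ.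
(* Forced by the row sums: 2k = c + b N. *)
exists ((2 * k - c) / N%:R).
have e1 : W *m W = D *: 1%:M - (D / N%:R) *: J by apply/eqP; rewrite eq_sym -subr_eq0 -/E E0.
have e2 : U *m (W *m W) = c *: (W *m W) by rewrite mulmxA UW -scalemxAl.
rewrite e1 mulmxBr -!scalemxAr mulmx1 UJ in e2.
apply: (scalerI (ltr0_neq0 D_lt0)); move/matrixP: e2 => e2.
apply/matrixP => i j; have := e2 i j; rewrite !mxE => e3.
rewrite -[LHS](subrK (D / N%:R * (2 * k * 1))) e3; field.
exact: N0'.
Qed.

(** With U = A + A^T and W = A - A^T one has 2Z = UW - WU, so 2 tr(Z^2) = tr(Z(UW - WU)), which
    vanishes by cyclicity of the trace when Z commutes with U. *)
Lemma normal_of_symmetric_commute A :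
    (A^T *m A - A *m A^T) *m (A + A^T) = (A + A^T) *m (A^T *m A - A *m A^T) ->
  A *m A^T = A^T *m A.
Proof.
set B := A^T; set Z := B *m A - A *m B => ZU.
have trZ : Z^T = Z by rewrite linearB /= !trmx_mul !trmxK.
suff : Z = 0 by move/eqP; rewrite subr_eq0 => /eqP.
apply: mxtrace_norm_eq0; rewrite trZ.
have e : 2 *: Z = (A + B) *m (A - B) - (A - B) *m (A + B).
  rewrite /Z mulmxDl !mulmxBr mulmxBl !mulmxDr; apply/matrixP => i j; rewrite !mxE; ring.
apply: (@mulfI _ 2) => //; rewrite mulr0 -mxtraceZ scalemxAr e.
rewrite mulmxBr linearB /= [in X in _ - X]mulmxA [X in _ - X]mxtrace_mulC.
by rewrite [in X in _ - X]mulmxA -ZU -[in X in _ - X]mulmxA subrr.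
Qed.

(** The left side telescopes to the commutator of P^2 with Q, in which I and J drop out. *)
Lemma commutator_anti P Q (a b g : rat) :
    J *m Q = Q *m J -> P *m P = a *: 1%:M + b *: J + g *: P ->
  P *m (P *m Q - Q *m P) + (P *m Q - Q *m P) *m P = g *: (P *m Q - Q *m P).
Proof.
move=> JQ PP; rewrite mulmxBr mulmxBl !mulmxA -[Q *m P *m P]mulmxA PP.
rewrite !mulmxDr !mulmxDl -!scalemxAl -!scalemxAr JQ mul1mx mulmx1.
apply/matrixP => i j; rewrite !mxE; ring.
Qed.

(** Moving P across Z turns it into g - P; moving it across twice restores P. *)
Lemma commutator_sqr_comm P Z (g : rat) :
  P *m Z + Z *m P = g *: Z -> P *m (Z *m Z) = Z *m Z *m P.
Proof.
move=> e; have PZ : P *m Z = g *: Z - Z *m P by rewrite -e addrK.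
rewrite mulmxA PZ mulmxBl -[Z *m P *m Z]mulmxA PZ mulmxBr -scalemxAl -scalemxAr mulmxA.
by rewrite opprB addrCA subrr addr0.
Qed.

(** Pairing PZ + ZP = gZ with Z gives 2 tr(P Z^2) = g tr(Z^2); inserting Z^2 = y (J - N I) and tr P
    = 0, the factor y cancels. *)
Lemma commutator_trace P Q (a b g x y : rat) :
    J *m P = P *m J -> J *m Q = Q *m J -> \tr P = 0 ->
    P *m P = a *: 1%:M + b *: J + g *: P ->
    (P *m Q - Q *m P) *m (P *m Q - Q *m P) = x *: 1%:M + y *: J -> x = - (y * N%:R) ->
    0 < y ->
  2 * \tr (P *m J) = - g * (N%:R * (N%:R - 1)).
Proof.
move=> JP JQ trP PP; have := commutator_anti JQ PP.
set Z := P *m Q - Q *m P => PZ ZZ xE y_gt0.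
clearbody Z.
have e : 2 * \tr (P *m (Z *m Z)) = g * \tr (Z *m Z).
  have -> : g * \tr (Z *m Z) = \tr ((P *m Z + Z *m P) *m Z).
    by rewrite PZ -scalemxAl linearZ.
  by rewrite mulmxDl mxtraceD -mulmxA -[Z *m P *m Z]mulmxA [\tr (Z *m _)]mxtrace_mulC -mulmxA; ring.
move: e; rewrite ZZ mulmxDr -!scalemxAr mulmx1 !linearD !linearZ /= trP mxtrace1 mxtrace_allone xE.
move=> e; apply: (mulfI (lt0r_neq0 y_gt0)); rewrite -[LHS]addr0.
transitivity (2 * (- (y * N%:R) * 0 + y * \tr (P *m J))); first by ring.
rewrite e; ring.
Qed.

End RationalMatrices.

(** * Homogeneous configurations of rank at most five *)

Section SmallRank.
Local Open Scope ring_scope.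
Variables (V : finType) (T : {set {set V * V}}).
Hypotheses (cohT : coherent T) (homT : homogeneous T).
Local Notation J := (const_mx 1 : 'M[rat]_#|V|).
Local Notation ind := (relmx rat).
Implicit Types M X Y : 'M[rat]_#|V|.

(** Membership in the rational form of the adjacency algebra, read off the entries. *)
Definition class_mx M := class_function T (fun a => M (enum_rank a.1) (enum_rank a.2)).

Lemma class_mxM M M' : class_mx M -> class_mx M' -> class_mx (M *m M').
Proof.
move=> cM cM' R RT a b aR bR; have := class_mul cohT cM cM' RT aR bR.
have e c : \sum_z M (enum_rank (c.1, z).1) (enum_rank (c.1, z).2) *
    M' (enum_rank (z, c.2).1) (enum_rank (z, c.2).2) =
    (M *m M') (enum_rank c.1) (enum_rank c.2).
  by rewrite mxE [RHS](reindex _ (onW_bij _ (@enum_rank_bij V))).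
by rewrite !e.
Qed.

Lemma class_mx_tr M : class_mx M -> class_mx M^T.
Proof.
move=> /(class_transpose cohT) cM R RT a b aR bR.
by rewrite !mxE; apply: (cM R).
Qed.

Lemma class_mxB M M' : class_mx M -> class_mx M' -> class_mx (M - M').
Proof.
move=> cM cM' R RT a b aR bR.
by rewrite !mxE (cM R RT a b aR bR) (cM' R RT a b aR bR).
Qed.

Lemma class_mxD M M' : class_mx M -> class_mx M' -> class_mx (M + M').
Proof.
move=> cM cM' R RT a b aR bR.
by rewrite !mxE (cM R RT a b aR bR) (cM' R RT a b aR bR).
Qed.

Lemma class_mx_ind D : union_of_basis T D -> class_mx (ind D).
Proof.
move=> /(class_union cohT) cD R RT a b aR bR; rewrite !mxE !enum_rankK -!surjective_pairing.
by rewrite (cD R RT a b aR bR).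
Qed.

Lemma basis_union R : R \in T -> union_of_basis T R.
Proof. by move=> RT; exists [set R]; rewrite ?sub1set // /cover big_set1. Qed.

Lemma class_value M R : class_mx M -> R \in T ->
  exists c, forall i j, (enum_val i, enum_val j) \in R -> M i j = c.
Proof.
move=> cM RT; have [->|/set0Pn[a aR]] := eqVneq R set0.
  by exists 0 => i j; rewrite inE.
exists (M (enum_rank a.1) (enum_rank a.2)) => i j ijR.
by rewrite -(cM R RT _ _ ijR aR) !enum_valK.
Qed.

(** The diagonal is a single class, so MJ and JM have constant diagonals and are multiples of J;
    comparing traces shows the factors agree. *)
Lemma class_mx_regular M : class_mx M -> exists r, M *m J = r *: J /\ J *m M = r *: J.
Proof.
move=> cM.
have cJ : class_mx J by move=> R RT a b _ _; rewrite !mxE.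
have [r rE] := class_value (class_mxM cM cJ) homT.
have [r' r'E] := class_value (class_mxM cJ cM) homT.
have e : M *m J = r *: J.
  apply/matrixP => i j; rewrite [RHS]mxE [X in _ * X]mxE mulr1 -(rE i i) ?inE //.
  by rewrite !mxE; apply: eq_bigr => k _; rewrite !mxE.
have e' : J *m M = r' *: J.
  apply/matrixP => i j; rewrite [RHS]mxE [X in _ * X]mxE mulr1 -(r'E j j) ?inE //.
  by rewrite !mxE; apply: eq_bigr => k _; rewrite !mxE.
exists r; split=> //; rewrite e'.
have [V0|V0] := posnP #|V|.
  by apply/matrixP => i; have := ltn_ord i; rewrite [X in (_ < X)%N]V0.
congr (_ *: _); have := mxtrace_mulC M J; rewrite e e' !mxtraceZ mxtrace_allone.
by move/(mulIf _) => -> //; rewrite pnatr_eq0 -lt0n.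
Qed.

Lemma class_mx_allone_comm M : class_mx M -> J *m M = M *m J.
Proof. by move=> /class_mx_regular[r [-> ->]]. Qed.

Lemma span_comm (P Q X Y : 'M[rat]_#|V|) :
    J *m P = P *m J -> J *m Q = Q *m J -> P *m Q = Q *m P ->
    (exists x0 x1 x2 x3, X = x0 *: 1%:M + x1 *: J + x2 *: P + x3 *: Q) ->
    (exists x0 x1 x2 x3, Y = x0 *: 1%:M + x1 *: J + x2 *: P + x3 *: Q) ->
  X *m Y = Y *m X.
Proof.
move=> JP JQ PQ hX hY.
have cZ (A B : 'M[rat]_#|V|) c : comm_mx A B -> comm_mx A (c *: B).
  by rewrite /comm_mx => e; rewrite -scalemxAr -scalemxAl e.
have comb A Z : comm_mx A J -> comm_mx A P -> comm_mx A Q ->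
    (exists x0 x1 x2 x3, Z = x0 *: 1%:M + x1 *: J + x2 *: P + x3 *: Q) -> comm_mx A Z.
  move=> AJ AP AQ [x0 [x1 [x2 [x3 ->]]]].
  by do !apply: comm_mxD; apply: cZ => //; apply: comm_mx1.
suff h A : comm_mx J A -> comm_mx P A -> comm_mx Q A -> comm_mx X A.
  by apply: (comb X Y) => //; apply: h.
move=> JA PA QA; apply: comm_mx_sym; apply: comb hX; exact: comm_mx_sym.
Qed.

Lemma relmx_tr (D : {set V * V}) : (ind D)^T = ind (transpose_rel D).
Proof. by apply/matrixP => i j; rewrite !mxE inE. Qed.

Lemma class_disjointF R R' a : R \in T -> R' \in T -> R != R' -> a \in R -> (a \in R') = false.
Proof.
move=> RT R'T RR' aR; apply/negP => aR'.
by rewrite (class_disjoint cohT RT R'T aR aR') eqxx in RR'.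
Qed.

Lemma class_nonempty R : R \in T -> exists a, a \in R.
Proof.
move=> RT; apply/set0Pn; have [/and3P[_ _ T0] _ _ _] := cohT.
by apply: contraNneq T0 => <-.
Qed.

Lemma trace_relmx_allone (D : {set V * V}) : \tr (ind D *m J) = #|D|%:R.
Proof.
rewrite /mxtrace -sum1_card natr_sum.
transitivity (\sum_i \sum_j (ind D) i j).
  by apply: eq_bigr => i _; rewrite mxE; apply: eq_bigr => j _; rewrite [X in _ * X]mxE mulr1.
transitivity (\sum_x \sum_y ((x, y) \in D)%:R : rat).
  rewrite [RHS](reindex _ (onW_bij _ (@enum_val_bij V))); apply: eq_bigr => i _ /=.
  by rewrite [RHS](reindex _ (onW_bij _ (@enum_val_bij V))); apply: eq_bigr => j _; rewrite mxE.
by rewrite [RHS]big_mkcond pair_bigA; apply: eq_bigr => -[x y] _ /=; case: (_ \in D).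
Qed.

(** P^2 and Z^2 lose their unwanted components because they commute with P, respectively with P and
    Q, while Z is nonzero. Then [commutator_trace] reads 2 #|P| = -g N (N - 1) with g an integer, so
    g is at most -1. *)
Lemma noncommuting_bound P Q R : P \in T -> Q \in T -> R \in T ->
    transpose_rel P = P -> transpose_rel Q = Q -> P != Q -> P != R -> Q != R ->
    P != diag_rel V -> R != diag_rel V -> Q != diag_rel V ->
    (forall X, class_mx X -> X^T = X -> exists x0 x1 x2 x3,
       X = x0 *: 1%:M + x1 *: J + x2 *: ind P + x3 *: ind Q) ->
    ind P *m ind Q != ind Q *m ind P ->
  (#|V| * #|V|.-1 <= 2 * #|P|)%N.
Proof.
move=> PT QT RT trP trQ PQ PR QR Pd Rd Qd span ncomm.
have cP := class_mx_ind (basis_union PT); have cQ := class_mx_ind (basis_union QT).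
have JP := class_mx_allone_comm cP; have JQ := class_mx_allone_comm cQ.
have sP : (ind P)^T = ind P by rewrite relmx_tr trP.
have sQ : (ind Q)^T = ind Q by rewrite relmx_tr trQ.
have sqr (S S' : {set V * V}) : (ind S)^T = ind S -> class_mx (ind S) ->
    exists x0 x1 x2 x3, ind S *m ind S = x0 *: 1%:M + x1 *: J + x2 *: ind P + x3 *: ind Q.
  by move=> sS cS; apply: span; [exact: class_mxM | rewrite trmx_mul sS].
have [a [b [g [z PPz]]]] := sqr P P sP cP.
have [a' [b' [z' [g' QQz]]]] := sqr Q Q sQ cQ.
pose Z := ind P *m ind Q - ind Q *m ind P.
have Z0 : Z != 0 by rewrite subr_eq0.
(* P commutes with P^2, so a component of P^2 along Q would force Z = 0. *)
have z0 : z = 0.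
  have : ind P *m (ind P *m ind P) = ind P *m ind P *m ind P by rewrite mulmxA.
  rewrite PPz !mulmxDr !mulmxDl -!scalemxAr -!scalemxAl mulmx1 mul1mx JP => /addrI/eqP.
  by rewrite -subr_eq0 -scalerBr scaler_eq0 (negbTE Z0) orbF => /eqP.
have z'0 : z' = 0.
  have : ind Q *m (ind Q *m ind Q) = ind Q *m ind Q *m ind Q by rewrite mulmxA.
  rewrite QQz !mulmxDr !mulmxDl -!scalemxAr -!scalemxAl mulmx1 mul1mx JQ => /addIr/addrI/eqP.
  rewrite -subr_eq0 -scalerBr scaler_eq0 -opprB oppr_eq0 (negbTE Z0) orbF => /eqP //.
rewrite z0 scale0r addr0 in PPz; rewrite z'0 scale0r addr0 in QQz.
have antiP := commutator_anti JQ PPz; rewrite -/Z in antiP.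
have antiQ : ind Q *m Z + Z *m ind Q = g' *: Z.
  have := commutator_anti JP QQz; rewrite -[ind Q *m ind P - _]opprB -/Z.
  by rewrite mulmxN mulNmx -opprD scalerN => /oppr_inj.
have sZ : Z^T = - Z by rewrite linearB /= !trmx_mul sP sQ opprB.
have cZ : class_mx Z by apply: class_mxB; apply: class_mxM.
have [x [y [w2 [w3 ZZ]]]] : exists x0 x1 x2 x3,
    Z *m Z = x0 *: 1%:M + x1 *: J + x2 *: ind P + x3 *: ind Q.
  by apply: span; [exact: class_mxM | rewrite trmx_mul sZ mulNmx mulmxN opprK].
have w30 : w3 = 0.
  have := commutator_sqr_comm antiP.
  rewrite ZZ !mulmxDr !mulmxDl -!scalemxAr -!scalemxAl mulmx1 mul1mx JP => /addrI/eqP.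
  by rewrite -subr_eq0 -scalerBr scaler_eq0 (negbTE Z0) orbF => /eqP.
have w20 : w2 = 0.
  have := commutator_sqr_comm antiQ.
  rewrite ZZ !mulmxDr !mulmxDl -!scalemxAr -!scalemxAl mulmx1 mul1mx JQ => /addIr/addrI/eqP.
  by rewrite -subr_eq0 -scalerBr scaler_eq0 -opprB oppr_eq0 (negbTE Z0) orbF => /eqP.
rewrite w20 w30 !scale0r !addr0 in ZZ.
have [[r1 r2] rR] := class_nonempty RT; have [[p1 p2] pP] := class_nonempty PT.
have V0 : (0 < #|V|)%N by apply/card_gt0P; exists r1.
pose i0 := enum_rank r1; pose j0 := enum_rank r2.
have N0 : #|V|%:R != 0 :> rat by rewrite pnatr_eq0 -lt0n.
(* Z has equal row and column sums and is skew, so they vanish. *)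
have ZJ : Z *m J = 0.
  have [r [e1 e2]] := class_mx_regular cZ.
  have e3 : (Z *m J)^T = - (r *: J) by rewrite trmx_mul sZ trmx_allone mulmxN e2.
  rewrite e1 in e3; move/matrixP/(_ i0 j0): e3; rewrite !mxE mulr1 => e3.
  have r0 : r = 0 by lra.
  by rewrite e1 r0 scale0r.
have xE : x = - (y * #|V|%:R).
  have : Z *m Z *m J = 0 by rewrite -mulmxA ZJ mulmx0.
  rewrite ZZ mulmxDl -!scalemxAl mul1mx mulmx_allone scalerA -scalerDl => /matrixP/(_ i0 j0).
  rewrite !mxE mulr1; lra.
have trZZ : \tr (Z *m Z) < 0.
  rewrite -oppr_gt0 -linearN /= -mulmxN -sZ lt_def mxtrace_norm_ge0 andbT.
  by apply: contraNneq Z0 => /mxtrace_norm_eq0 ->.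
have cardV1 : #|V|%:R - 1 = #|V|.-1%:R :> rat by rewrite -[in LHS](prednK V0) -natr1 addrK.
have y_gt0 : 0 < y.
  move: trZZ; rewrite ZZ mxtraceD !mxtraceZ mxtrace1 mxtrace_allone xE => e.
  have : 0 < y * (#|V|%:R * #|V|.-1%:R) by rewrite -cardV1; nra.
  by apply: contraTT; rewrite -!leNgt => y0; rewrite mulr_le0_ge0 // mulr_ge0 // ler0n.
have notin S i : S \in T -> S != diag_rel V -> ((enum_val i, enum_val i) \in S) = false.
  move=> ST Sd; apply/negP => iS; move: Sd; rewrite (class_disjoint cohT ST homT iS) ?eqxx //.
  by rewrite inE.
have trP0 : \tr (ind P) = 0.
  by rewrite /mxtrace big1 // => i _; rewrite mxE notin.
have := commutator_trace JP JQ trP0 PPz ZZ xE y_gt0.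
rewrite trace_relmx_allone cardV1 => e.
have ne1 S s1 s2 : S \in T -> S != diag_rel V -> (s1, s2) \in S ->
    (enum_rank s1 == enum_rank s2) = false.
  move=> ST Sd sS; apply/negP => /eqP/enum_rank_inj es; move: sS; rewrite es.
  by rewrite -(enum_rankK s2) notin.
(* Evaluating P^2 at a pair of R and at a pair of P exhibits b and b + g as counts, whence g is an
   integer. *)
have eR : b = #|[set z | ((r1, z) \in P) && ((z, r2) \in P)]|%:R.
  have := mulmx_relmx rat P P i0 j0; rewrite PPz !enum_rankK => <-.
  rewrite !mxE !enum_rankK (ne1 _ _ _ RT Rd rR) (class_disjointF RT PT _ rR) 1?eq_sym //.
  by rewrite !mulr0 mulr1 add0r addr0.
have eP : b + g = #|[set z | ((p1, z) \in P) && ((z, p2) \in P)]|%:R.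
  have := mulmx_relmx rat P P (enum_rank p1) (enum_rank p2); rewrite PPz !enum_rankK => <-.
  by rewrite !mxE !enum_rankK (ne1 _ _ _ PT Pd pP) pP mulr0 !mulr1 add0r.
set n1 := #|[set z | ((r1, z) \in P) && _]| in eR; set n2 := #|_| in eP.
have gE : g = n2%:R - n1%:R by rewrite -eP -eR addrC addKr.
have P_gt0 : (0 < #|P|)%N by apply/card_gt0P; exists (p1, p2).
set K := (#|V| * #|V|.-1)%N in e *.
have {}e : (2 * #|P| + n2 * K = n1 * K)%N.
  by apply/eqP; rewrite -(eqr_nat rat) natrD !natrM e gE; apply/eqP; ring.
have n12 : (n2 < n1)%N.
  rewrite ltnNge; apply/negP => le; move: (leq_mul le (leqnn K)).
  by rewrite -e addnC -{2}[(n2 * K)%N]addn0 leq_add2l leqn0 muln_eq0 /= eqn0Ngt P_gt0.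
by rewrite -(leq_add2r (n2 * K)) e -mulSn leq_mul2r n12 orbT.
Qed.

Lemma transpose_relK : involutive (@transpose_rel V).
Proof. by move=> D; apply/setP => -[x y]; rewrite !inE. Qed.

Lemma transpose_diag : transpose_rel (diag_rel V) = diag_rel V.
Proof. by apply/setP => -[x y]; rewrite !inE eq_sym. Qed.

(** Besides the diagonal, R and its transpose at most two classes remain. Symmetric matrices agree
    on R and its transpose, so only two symmetric classes P and Q could obstruct commutation. *)
Lemma symmetric_class_commute R : (rank T <= 5)%N -> R \in T -> transpose_rel R != R ->
  forall X Y, class_mx X -> X^T = X -> class_mx Y -> Y^T = Y -> X *m Y = Y *m X.
Proof.
move=> rT RT asymR.
set d := diag_rel V; set R' := transpose_rel R.
have dT : d \in T by exact: homT.
have [_ _ trT _] := cohT.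
have R'T : R' \in T by exact: trT.
have Rd : R != d by apply: contraNneq asymR => ->; rewrite transpose_diag.
have R'd : R' != d.
  by apply: contraNneq Rd => e; rewrite -[R]transpose_relK -/R' e transpose_diag.
pose S := T :\: [set d; R; R'].
have card_S : (#|S| <= 2)%N.
  have sub : [set d; R; R'] \subset T by rewrite !subUset !sub1set dT RT R'T.
  rewrite /S cardsDS // -setUA cardsU1 cards2 !inE negb_or.
  rewrite ![d == _]eq_sym Rd R'd [R == _]eq_sym asymR.
  by move: rT; rewrite /rank; lia.
have inS D : (D \in S) = [&& D != d, D != R, D != R' & D \in T].
  by rewrite !inE !negb_or -!andbA.
have trS D : D \in S -> transpose_rel D \in S.
  rewrite !inS => /and4P[Dd DR DR' DT]; apply/and4P; split; last exact: trT.
  - by apply: contraNneq Dd => e; rewrite -[D]transpose_relK e transpose_diag.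
  - by apply: contraNneq DR' => e; rewrite -[D]transpose_relK e.
  - by apply: contraNneq DR => e; rewrite -[D]transpose_relK e transpose_relK.
have value X : class_mx X -> X^T = X -> exists x0 xR,
    [/\ forall i, X i i = x0,
        forall i j, (enum_val i, enum_val j) \in R -> X i j = xR &
        forall i j, (enum_val i, enum_val j) \in R' -> X i j = xR].
  move=> cX sX; have [x0 x0E] := class_value cX dT; have [xR xRE] := class_value cX RT.
  exists x0, xR; split=> // [i|i j]; first by apply: x0E; rewrite inE.
  by rewrite inE => ijR; rewrite -sX mxE; apply: xRE.
have cases a : [\/ a \in d, a \in R, a \in R' | exists2 D, D \in S & a \in D].
  have [D DT aD] := class_cover cohT a.
  have [Dd|Dd] := eqVneq D d; first by constructor 1; rewrite -Dd.
  have [DR|DR] := eqVneq D R; first by constructor 2; rewrite -DR.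
  have [DR'|DR'] := eqVneq D R'; first by constructor 3; rewrite -DR'.
  by constructor 4; exists D; rewrite // inS Dd DR DR' DT.
have coverF D0 a : D0 \in T -> D0 \notin S -> a \in D0 -> (a \in cover S) = false.
  move=> D0T D0S aD0; apply/negP => /bigcupP[D DS aD]; case/negP: D0S.
  have DT : D \in T by move: DS; rewrite inS => /and4P[].
  by rewrite (class_disjoint cohT D0T DT aD0 aD).
have dS : d \notin S by rewrite inS eqxx.
have RS : R \notin S by rewrite inS eqxx andbF.
have R'S : R' \notin S by rewrite inS eqxx !andbF.
have offdiag D (i j : 'I_#|V|) : D \in T -> D != d ->
    (enum_val i, enum_val j) \in D -> (i == j) = false.
  move=> DT Dd ijD; apply/negP => /eqP ij; rewrite ij in ijD.
  have /eqP := class_disjointF DT dT Dd ijD; by rewrite inE eqxx.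
(* First case: the remaining classes amount to none, one, or a transposed pair, so a symmetric
   matrix is constant on their union and lies in the span of I, J and one more matrix. *)
have [/forall_inP easy|] := boolP [forall D1 in S,
  forall D2 in S, (D1 == D2) || (D2 == transpose_rel D1)].
  have ST : S \subset T by apply: subsetDl.
  have cS : class_mx (ind (cover S)) by apply: class_mx_ind; exists S.
  have JS := class_mx_allone_comm cS.
  have span X : class_mx X -> X^T = X -> exists x0 x1 x2 x3 : rat,
      X = x0 *: 1%:M + x1 *: J + x2 *: ind (cover S) + x3 *: 0.
    move=> cX sX; have [x0 [xR [x0E xRE xR'E]]] := value X cX sX.
    have [xS xSE] : exists xS, forall i j, (enum_val i, enum_val j) \in cover S -> X i j = xS.
      have [->|/set0Pn[D1 D1S]] := eqVneq S set0.
        by exists 0 => i j /bigcupP[D]; rewrite inE.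
      have [xS xSE] := class_value cX (subsetP ST _ D1S); exists xS => i j /bigcupP[D DS ijD].
      have /forall_inP/(_ D DS)/orP[/eqP eD|/eqP eD] := easy D1 D1S.
        by apply: xSE; rewrite eD.
      by rewrite -sX mxE; apply: xSE; move: ijD; rewrite eD inE.
    exists (x0 - xR), xR, (xS - xR), 0; apply/matrixP => i j; rewrite !mxE.
    case: (cases (enum_val i, enum_val j)) => [ijd|ijR|ijR'|[D DS ijD]].
    - rewrite (coverF d) //.
      have /eqP/enum_val_inj -> : enum_val i == enum_val j by move: ijd; rewrite inE.
      rewrite x0E eqxx /=; ring.
    - rewrite (coverF R) // (offdiag R) // xRE //=; ring.
    - rewrite (coverF R') // (offdiag R') // xR'E //=; ring.
    have ijc : (enum_val i, enum_val j) \in cover S by apply/bigcupP; exists D.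
    rewrite ijc xSE // (offdiag D) //=; first by ring.
      exact: (subsetP ST).
    by move: DS; rewrite inS => /and4P[].
  move=> X Y cX sX cY sY; apply: (span_comm JS _ _ (span X cX sX) (span Y cY sY));
  by rewrite mulmx0 mul0mx.
rewrite negb_forall_in => /exists_inP[P PS]; rewrite negb_forall_in => /exists_inP[Q QS].
rewrite negb_or => /andP[PQ QP].
(* Second case: two classes that are not transposes of each other exhaust S, so each is
   symmetric. *)
have SE : S = [set P; Q].
  by apply/esym/eqP; rewrite eqEcard subUset !sub1set PS QS cards2 PQ.
have trP : transpose_rel P = P.
  have := trS P PS; rewrite {1}SE !inE => /orP[/eqP //|/eqP e].
  by rewrite e eqxx in QP.
have trQ : transpose_rel Q = Q.
  have := trS Q QS; rewrite {1}SE !inE => /orP[/eqP e|/eqP //].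
  by rewrite -e transpose_relK eqxx in QP.
have [Pd PR PR' PT] : [/\ P != d, P != R, P != R' & P \in T] by apply/and4P; rewrite -inS.
have [Qd QR QR' QT] : [/\ Q != d, Q != R, Q != R' & Q \in T] by apply/and4P; rewrite -inS.
have span X : class_mx X -> X^T = X -> exists x0 x1 x2 x3 : rat,
    X = x0 *: 1%:M + x1 *: J + x2 *: ind P + x3 *: ind Q.
  move=> cX sX; have [x0 [xR [x0E xRE xR'E]]] := value X cX sX.
  have [xP xPE] := class_value cX PT; have [xQ xQE] := class_value cX QT.
  exists (x0 - xR), xR, (xP - xR), (xQ - xR); apply/matrixP => i j; rewrite !mxE.
  have F D D' := @class_disjointF D D' (enum_val i, enum_val j).
  case: (cases (enum_val i, enum_val j)) => [ijd|ijR|ijR'|[D DS ijD]].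
  - rewrite (F d P) 1?eq_sym // (F d Q) 1?eq_sym //.
    have /eqP/enum_val_inj -> : enum_val i == enum_val j by move: ijd; rewrite inE.
    rewrite x0E eqxx /=; ring.
  - rewrite (F R P) 1?eq_sym // (F R Q) 1?eq_sym // (offdiag R) // xRE //=; ring.
  - rewrite (F R' P) 1?eq_sym // (F R' Q) 1?eq_sym // (offdiag R') // xR'E //=; ring.
  move: DS ijD; rewrite SE !inE => /orP[/eqP ->|/eqP ->] ijD.
    by rewrite ijD (F P Q) // (offdiag P) // xPE //=; ring.
  have Q_P : Q != P by rewrite eq_sym.
  by rewrite ijD (F Q P) // (offdiag Q) // xQE //=; ring.
have cP := class_mx_ind (basis_union PT); have cQ := class_mx_ind (basis_union QT).
have JP := class_mx_allone_comm cP; have JQ := class_mx_allone_comm cQ.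
have [comm|ncomm] := eqVneq (ind P *m ind Q) (ind Q *m ind P).
  by move=> X Y cX sX cY sY; apply: (span_comm JP JQ comm (span X cX sX) (span Y cY sY)).
(* P and Q would each contain at least half of the off-diagonal pairs, leaving none for R. *)
exfalso.
have arith (r p q c : nat) : (r + (p + (q + c)) <= 2 * p -> r + (p + (q + c)) <= 2 * q ->
    0 < r -> False)%N by clear; lia.
have boundP := noncommuting_bound PT QT RT trP trQ PQ PR QR Pd Rd Qd span ncomm.
have boundQ : (#|V| * #|V|.-1 <= 2 * #|Q|)%N.
  apply: (@noncommuting_bound Q P R); rewrite // 1?eq_sym //.
  move=> X cX sX; have [x0 [x1 [x2 [x3 e]]]] := span X cX sX.
  by exists x0, x1, x3, x2; rewrite e -!addrA; congr (_ + (_ + _)); rewrite addrC.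
have card_d : #|d| = #|V|.
  rewrite -(card_imset (f := fun x : V => (x, x)) V); last by move=> x y [].
  apply: eq_card => -[x y]; rewrite inE /=.
  by apply/eqP/imsetP => [<-|[z _ [-> ->]] //]; exists x.
have R_gt0 : (0 < #|R|)%N by apply/card_gt0P; exact: class_nonempty.
have partT : partition T [set: V * V] by case: cohT.
have := card_partition partT; rewrite cardsT card_prod.
rewrite (bigD1 d) // (bigD1 R) ?RT ?Rd //= (bigD1 P) ?PT ?Pd ?PR //=.
rewrite (bigD1 Q) ?QT ?Qd ?QR 1?eq_sym ?PQ //= card_d.
have : (#|V| * #|V|.-1 + #|V| = #|V| * #|V|)%N.
  by case: #|V| => // N; rewrite /= mulnS addnC.
set rest : nat := \sum_(i | _) _; clearbody rest.
move=> e1 e2; rewrite -e1 addnC in e2; move/addnI: e2 => e2.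
rewrite e2 in boundP boundQ.
exact: (arith _ _ _ _ boundP boundQ R_gt0).
Qed.

End SmallRank.


(** As 0 < t < k, a vertex x has a reciprocated arc to some z and an unreciprocated arc to some y.
    The class of (x, y) is asymmetric, so rank at most five makes A normal and A + A^T = c I + b J;
    but its entries at (x, z) and (x, y) are 2 and 1. *)
Theorem proper_dsrg_scheme_rank (G : digraph) (S : {set {set G * G}}) :
  scheme_of_proper_dsrg G S -> 6 <= rank S.
Proof.
case=> [[v [k [t [l [m [dsrgG /andP[t_gt0 tk]]]]]]] [cS hS] uS].
rewrite leqNgt; apply/negP => rS.
have [/dsrgP[_ outd ind cc]] := (dsrgG, tt).
have [[x x'] _] := class_nonempty cS hS.
have [z] : exists z, z \in [set z | ((x, z) \in arcs G) && ((z, x) \in arcs G)].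
  by apply/card_gt0P; rewrite cc eqxx.
rewrite inE => /andP[xz zx].
have [y xy yx] : exists2 y, (x, y) \in arcs G & (y, x) \notin arcs G.
  have /subsetPn[y] : ~~ ([set y | (x, y) \in arcs G] \subset
      [set z | ((x, z) \in arcs G) && ((z, x) \in arcs G)]).
    by apply: contraL tk => /subset_leq_card; rewrite outd cc eqxx leqNgt.
  by rewrite !inE => xy; rewrite xy; exists y.
have cA := class_union cS uS.
have [R RS xyR] := class_cover cS (x, y).
have asymR : transpose_rel R != R.
  apply: contra yx => /eqP eR; rewrite -(cA R RS _ _ xyR) ?xy //.
  by rewrite -eR inE.
pose A := relmx rat (arcs G).
have clA : class_mx S A by apply: class_mx_ind.
have clAt := class_mx_tr cS clA.
have nA : (A *m A^T = A^T *m A)%R.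
  apply: normal_of_symmetric_commute; apply: (symmetric_class_commute cS hS rS RS asymR).
  - by apply: class_mxB; apply: class_mxM.
  - by rewrite linearB /= !trmx_mul !trmxK.
  - exact: class_mxD.
  - by rewrite linearD /= trmxK addrC.
pose J : 'M[rat]_#|G| := const_mx 1%R.
have JE : J = relmx rat [set: G * G] by apply/matrixP => i j; rewrite !mxE inE.
have asymA : (A^T != A)%R.
  apply/negP => /eqP/matrixP/(_ (enum_rank x) (enum_rank y)).
  by rewrite !mxE !enum_rankK xy (negbTE yx).
have G0 : 0 < #|G| by apply/card_gt0P; exists x.
have AA : (A *m A = (l%:R - m%:R) *: A + (t%:R - m%:R) *: 1%:M + m%:R *: J)%R.
  apply/matrixP => i j; rewrite mulmx_relmx cc !mxE (can_eq enum_valK).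
  have [->|ij] := eqVneq i j; first by rewrite (negbTE (arcs_loopless _)) /=; ring.
  by case: ((_, _) \in arcs G) => /=; ring.
have AJ : (A *m J = k%:R *: J)%R.
  apply/matrixP => i j; rewrite JE mulmx_relmx !mxE inE mulr1 -(outd (enum_val i)).
  by congr (_%:R)%R; apply: eq_card => u; rewrite !inE andbT.
have JA : (J *m A = k%:R *: J)%R.
  apply/matrixP => i j; rewrite JE mulmx_relmx !mxE inE mulr1 -(ind (enum_val j)).
  by congr (_%:R)%R; apply: eq_card => u; rewrite !inE.
have [b /matrixP bE] := normal_quadratic G0 AJ JA AA nA asymA.
have nloop u : (x, u) \in arcs G -> (enum_rank x == enum_rank u) = false.
  by move=> xu; apply/negP => /eqP/enum_rank_inj e; rewrite -e (negbTE (arcs_loopless x)) in xu.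
have := bE (enum_rank x) (enum_rank y); have := bE (enum_rank x) (enum_rank z).
rewrite !mxE !enum_rankK xy (negbTE yx) xz zx !nloop // => <-.
by move/eqP; rewrite eq_sym.
Qed.

(** * Sharpness of the rank bound and the infinite family *)

Lemma smallest_possible_rank6 : smallest_possible_rank 6.
Proof.
split; last exact: proper_dsrg_scheme_rank.
(* The prime p = 13 attains rank six, with parameters (54, 26, 13, 12, 13). *)
have [G [_ dG [S [[cS aS mS] sS _ rS]]]] := szekeres_digraph (isT : prime 13) erefl isT.
exists G, S => //; split=> //; first by exists 54, 26, 13, 12, 13; split.
exact: union_of_class_function (class_adjmx cS aS).
Qed.

Theorem theorem1p1 :
  (forall p : nat, prime p -> p = 5 %[mod 8] -> 13 <= p ->
     exists G : digraph,
       [/\ intransitive G,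
           dsrg G (4 * p + 2) (2 * p) p (p - 1) p &
           has_noncommutative_WL_scheme_of_rank G 6]) /\
  (smallest_possible_rank 6 /\
   exists G : nat -> digraph,
     (forall i j : nat, i <> j -> ~ digraph_iso (G i) (G j)) /\
     (forall i : nat,
        [/\ exists v k t l m : nat, dsrg (G i) v k t l m,
            intransitive (G i) &
            has_noncommutative_WL_scheme_of_rank (G i) 6])).
Proof.
split; first exact: szekeres_digraph.
split; first exact: smallest_possible_rank6.
have [next nextP] := boolp.choice primes_5mod8_unbounded.
(* A strictly increasing sequence of admissible primes starting above 12; the orders 4p + 2 are then
   distinct, which rules out isomorphisms. *)
pose p := fix p i := if i is j.+1 then next (p j) else next 12.
have p_lt i : p i < p i.+1 by case: (nextP (p i)).
have p_gt12 i : 12 < p i.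
  by elim: i => [|i IHi]; [case: (nextP 12) | exact: ltn_trans IHi (p_lt i)].
have pP i : prime (p i) /\ p i = 5 %[mod 8].
  by case: i => [|i]; [case: (nextP 12) | case: (nextP (p i))].
have [G GP] := boolp.choice (fun i => szekeres_digraph (pP i).1 (pP i).2 (p_gt12 i)).
exists G; split=> [i j ij [f f_bij _]|i].
  apply: ij; have mono : {mono p : x y / x <= y}.
    by apply: leq_mono; apply: homo_ltn => //; apply: ltn_trans.
  apply: (incn_inj mono).
  have cG k : #|G k| = 4 * p k + 2 by have [_ []] := GP k.
  have := bij_eq_card f_bij; rewrite !cG; lia.
have [iG dG wG] := GP i; split=> //.
by exists (4 * p i + 2), (2 * p i), (p i), (p i - 1), (p i).
Qed.
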